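(* Let $n\ge2$, let $\Bbbk$ be a field, and suppose the finite poset $P$ has a unique minimal element $a$. Then for all $i\geq 0$ and $j$ the graded Betti number $\beta_{i,j}(L(n,P))$ equals the sum $$\beta_{i,j}(L(n,P\setminus\{a\}))+\beta_{i,j-1}(L(n-1,P))+\beta_{i-1,j-1}(L(n,P\setminus\{a\})).$$
   Context: For a finite poset $Q$ and $m\ge1$, the $m$'th letterplace ideal $L(m,Q)$ is the ideal in $\Bbbk[x_{i,q}:(i,q)\in[m]\times Q]$, $[m]=\{1<\dots<m\}$, generated by the monomials $x_{1,q_1}x_{2,q_2}\cdots x_{m,q_m}$ with $q_1\le q_2\le\cdots\le q_m$ in $Q$. For a homogeneous ideal $I$ in a polynomial ring $S$ over $\Bbbk$, $\beta_{i,j}(I)=\dim_\Bbbk\mathrm{Tor}_i^S(I,\Bbbk)_j$ (so generators are in homological degree $0$), with $\beta_{-1,j}=0$. $P\setminus\{a\}$ has the induced order. *)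

(* Defs.v *)
From HB Require Import structures.
From Stdlib Require Import ClassicalEpsilon.
From mathcomp Require Import all_boot all_order all_algebra.
From mathcomp Require Import mpoly.

Set Implicit Arguments.
Unset Strict Implicit.
Unset Printing Implicit Defensive.

Import Order.TTheory GRing.Theory.

Local Open Scope ring_scope.

Definition minimal (d : Order.disp_t) (P : porderType d) (a : P) : Prop :=
  forall b : P, ~~ (b < a)%O.

Definition unique_minimal (d : Order.disp_t) (P : porderType d) (a : P) :
    Prop :=
  minimal a /\ forall b : P, minimal b -> b = a.

Definition poset_del (d : Order.disp_t) (P : finPOrderType d) (a : P) : Type :=
  {x : P | x != a}.

Section PosetDel.
Variables (d : Order.disp_t) (P : finPOrderType d) (a : P).
HB.instance Definition _ := SubFinite.on (poset_del a).
(* The order of [poset_del a] is the restriction of the order of [P]. *)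
HB.instance Definition _ := [SubChoice_isSubPOrder of poset_del a by <: with d].
End PosetDel.

Definition ideal_span (R : comNzRingType) (T : finType) (D : pred T)
    (g : T -> R) : R -> Prop :=
  fun f => exists c : T -> R, f = \sum_(t | D t) c t * g t.

Section Letterplace.
Variables (k : fieldType) (m : nat) (d : Order.disp_t) (Q : finPOrderType d).

(* [m] is represented by 'I_m = {0, ..., m-1}; multivariate polynomials are
   indexed by ordinals, whence the enumeration of [m] x Q. *)
Definition lp_ring := {mpoly k[#|{: 'I_m * Q}|]}.

Definition lp_var (i : 'I_m) (q : Q) : lp_ring := 'X_(enum_rank (i, q)).

Definition multichain (q : {ffun 'I_m -> Q}) : bool :=
  [forall i : 'I_m, forall j : 'I_m, (i <= j)%N ==> (q i <= q j)%O].

Definition letterplace : lp_ring -> Prop :=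
  ideal_span multichain
    (fun q : {ffun 'I_m -> Q} => \prod_(i < m) lp_var i (q i)).

End Letterplace.

Arguments letterplace k m {d} Q.

Section Betti.
Variables (k : fieldType) (N : nat).
Local Notation S := {mpoly k[N]}.

(* A graded free resolution ... -> F_1 -> F_0 -> I -> 0 by free S-modules of
   finite rank. F_i is the module of row vectors 'rV[S]_(rk i), whose v-th basis
   vector sits in degree [dg v], i.e. F_i = (+)_v S(- dg v); the maps act by
   right multiplication. The [_homog] fields say that the maps preserve
   degrees (a zero entry has empty support, so is always allowed). *)
Record graded_free_resolution (I : S -> Prop) := GradedFreeResolution {
  rk : nat -> nat;
  dg : forall i, 'I_(rk i) -> int;
  aug : 'cV[S]_(rk 0);
  diff : forall i, 'M[S]_(rk i.+1, rk i);
  aug_homog : forall u, {in msupp (aug u ord0), forall mon : 'X_{1..N},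
    (mdeg mon)%:Z = dg u};
  diff_homog : forall i u v, {in msupp (diff i u v), forall mon : 'X_{1..N},
    (mdeg mon)%:Z + dg v = dg u};
  aug_im : forall f, I f <-> exists w : 'rV_(rk 0), (w *m aug) ord0 ord0 = f;
  aug_ker : forall w : 'rV_(rk 0),
    w *m aug = 0 <-> exists z : 'rV_(rk 1), w = z *m diff 0;
  diff_ker : forall i (w : 'rV_(rk i.+1)),
    w *m diff i = 0 <-> exists z : 'rV_(rk i.+2), w = z *m diff i.+1
}.

Section Tor.
Variables (I : S -> Prop) (F : graded_free_resolution I).

(* The complex F (x)_S k, where k = S / (x_1, ..., x_N): its i-th term is
   k^(rk i), and its maps are obtained by taking constant coefficients. *)
Definition tor_diff (i : nat) : 'M[k]_(rk F i.+1, rk F i) :=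
  map_mx (mcoeff 0%MM) (diff F i).

(* The row space of [tor_chains i j] is the degree-j part of F_i (x) k. *)
Definition tor_chains (i : nat) (j : int) : 'M[k]_(rk F i) :=
  diag_mx (\row_v (dg v == j)%:R).

Definition tor_cycles (i : nat) (j : int) : 'M[k]_(rk F i) :=
  match i with
  | 0 => tor_chains 0 j
  | i'.+1 => (tor_chains i'.+1 j :&: kermx (tor_diff i'))%MS
  end.

Definition tor_boundaries (i : nat) (j : int) : 'M[k]_(rk F i.+1, rk F i) :=
  tor_chains i.+1 j *m tor_diff i.

(* dim_k H_i(F (x)_S k)_j; the subtraction is not truncated, since boundaries
   are cycles. *)
Definition tor_dim (i : nat) (j : int) : nat :=
  (\rank (tor_cycles i j) - \rank (tor_boundaries i j))%N.

End Tor.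

(* beta_{i,j}(I) = dim_k Tor_i^S(I, k)_j, computed from some graded free
   resolution of I; a homogeneous ideal has one by Hilbert's basis theorem, and
   the value does not depend on it. It is 0 in negative homological degrees. *)
Definition betti (I : S -> Prop) (i j : int) : nat :=
  match i with
  | Posz i' => epsilon (inhabits 0%N)
      (fun b => exists F : graded_free_resolution I, tor_dim F i' j = b)
  | Negz _ => 0%N
  end.

End Betti.

(* Main.v *)
From HB Require Import structures.
From Stdlib Require Import ClassicalEpsilon.
Require Import Defs.
From mathcomp Require Import all_boot all_order all_algebra.
From mathcomp Require Import mpoly zify.

Set Implicit Arguments.
Unset Strict Implicit.
Unset Printing Implicit Defensive.

Import Order.TTheory GRing.Theory Num.Theory.

Local Open Scope ring_scope.

(** Among the generators of [L = L(n, P)], those starting at the least element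
    [a] are [x = x_(1,a)] times a generator of [L' = L(n-1, P)], placed in the
    rows [2, ..., n]; the others generate [L'' = L(n, P - a)]. Hence
    [L = x L' + L''], where [L''] is contained in [L'] and [x] occurs in the
    generators of neither ideal, so that [x L'] and [L''] meet in [x L'']. This
    gives an exact sequence
      [0 -> L''(-1) -> L'(-1) (+) L'' -> L -> 0],
    whose first map is the inclusion on one summand and multiplication by [-x]
    on the other. The formula says that this map vanishes on [Tor]. It does:
    multiplication by [x] is zero on [Tor], and the inclusion is zero because
    every monomial of [L''] contains a variable of the first row, while a
    resolution of [L'] involves only the other rows. Concretely, the inclusion
    lifts to a chain map all of whose entries lie in the ideal of the variables
    of the first row.

    At the level of complexes, [L] is resolved by the mapping cone of a lift of
    the first map ([mon_cone_resolves]). When this lift is zero modulo the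
    variables, the homology of the cone tensored with [k] is the direct sum
    ([tordim_mon_cone]); the lift with entries in the prescribed ideal comes
    from [resolution_lift] and [lifts_in_new_vars].

    Three classical facts connect this with the Betti numbers. A Betti number
    may be computed from any resolution, since two resolutions are homotopy
    equivalent ([tordim_unique], [betti_tordim]). Every monomial ideal has a
    resolution by finite free modules, by iterating the same cone construction
    over the generators ([generated_resolution]). Adjoining variables is flat,
    so it preserves resolutions and their Betti numbers ([ext_resolves],
    [tordim_ext]); this moves [L'] and [L''] into the ring of [L].

    Ideals are handled through their sets of monomials: membership in a
    monomial ideal is tested on the support, which turns sums, intersections
    and colons of ideals into boolean combinations of predicates. *)

(** * Ideals cut out by sets of monomials *)

Section Monomials.
Variables (k : fieldType) (N : nat).
Local Notation S := {mpoly k[N]}.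
Local Notation mon := 'X_{1..N}.
Implicit Types (p q f : S) (m : mon) (Q U V : pred mon).

(** Homogeneous components, the splitting of a sum of monomial ideals, and the
    projection onto a polynomial subring are all of this form. *)
Definition restr Q p : S := \sum_(m <- msupp p | Q m) p@_m *: 'X_[m].

Lemma mcoeff_restr Q p m : (restr Q p)@_m = if Q m then p@_m else 0.
Proof.
rewrite /restr raddf_sum /=.
have [mp|] := boolP (m \in msupp p); last first.
  rewrite -mcoeff_eq0 => /eqP pm0; rewrite pm0 if_same big1 // => m' _.
  rewrite mcoeffZ mcoeffX; case: eqP => [->|_]; by rewrite ?pm0 (mul0r, mulr0).
rewrite big_mkcond /= (bigD1_seq m) ?msupp_uniq //= big1 ?addr0.
  by case: (Q m); rewrite // mcoeffZ mcoeffX eqxx mulr1.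
move=> m' /negPf nm; case: (Q m') => //.
by rewrite mcoeffZ mcoeffX nm mulr0.
Qed.

Lemma msupp_restr Q p m : (m \in msupp (restr Q p)) = Q m && (m \in msupp p).
Proof. by rewrite !mcoeff_msupp mcoeff_restr; case: (Q m); rewrite ?eqxx. Qed.

Lemma restr_is_additive Q : {morph restr Q : p q / p - q}.
Proof.
move=> p q; apply/mpolyP => m; rewrite mcoeffB !mcoeff_restr mcoeffB.
by case: (Q m); rewrite ?subrr.
Qed.

HB.instance Definition _ Q := GRing.isZmodMorphism.Build S S (restr Q)
  (restr_is_additive Q).

Lemma restr_id Q p : all Q (msupp p) -> restr Q p = p.
Proof.
move=> /allP h; apply/mpolyP => m; rewrite mcoeff_restr.
case: ifP => // /negbT nQ; apply/esym/eqP; rewrite mcoeff_eq0.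
by apply: contra nQ; apply: h.
Qed.

Lemma restrC Q p : restr Q p + restr (predC Q) p = p.
Proof.
apply/mpolyP => m; rewrite mcoeffD !mcoeff_restr /=.
by case: (Q m); rewrite ?addr0 ?add0r.
Qed.

(** The source of all linearity properties of restriction: for [Q] and [Q'] of
    degrees [e] and [e - deg q], it makes homogeneous components linear over a
    homogeneous [q]; for [Q = Q'] reading only some of the variables, it gives
    linearity over the polynomials in the other variables. *)
Lemma restrM Q Q' p q :
  (forall m m', m' \in msupp q -> Q (m + m')%MM = Q' m) ->
  restr Q (p * q) = restr Q' p * q.
Proof.
move=> h; apply/mpolyP => m; rewrite mcoeff_restr !mcoeffM.
case: ifP => Qm; [|apply/esym/big1]; last first.
  move=> kk /eqP e; rewrite mcoeff_restr; case: ifP => Q1; rewrite ?mul0r //.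
  case: (boolP (val kk.2 \in msupp q)) => [/(h (val kk.1))|].
    by rewrite -e Qm Q1.
  by rewrite -mcoeff_eq0 => /eqP ->; rewrite mulr0.
apply: eq_bigr => kk /eqP e; rewrite mcoeff_restr; case: ifP => // Q1.
case: (boolP (val kk.2 \in msupp q)) => [/(h (val kk.1))|].
  by rewrite -e Qm Q1.
by rewrite -mcoeff_eq0 => /eqP ->; rewrite !mulr0.
Qed.

(** A polynomial lies in a monomial ideal exactly when all its monomials do;
    for an up-closed [U] this predicate is thus the ideal spanned by [U]. *)
Definition mon_ideal U f : bool := all U (msupp f).

Definition upclosed U := forall m m', U m -> U (m + m')%MM.

Lemma mon_ideal0 U : mon_ideal U 0.
Proof. by rewrite /mon_ideal msupp0. Qed.

Lemma mon_idealD U p q : mon_ideal U p -> mon_ideal U q -> mon_ideal U (p + q).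
Proof.
move=> /allP hp /allP hq; apply/allP => m /msuppD_le.
by rewrite mem_cat => /orP[/hp|/hq].
Qed.

Lemma mon_idealN U p : mon_ideal U (- p) = mon_ideal U p.
Proof. by rewrite /mon_ideal; apply: perm_all; apply: msuppN. Qed.

Lemma mon_ideal_sum U (T : Type) (r : seq T) (P : pred T) (F : T -> S) :
  (forall t, P t -> mon_ideal U (F t)) -> mon_ideal U (\sum_(t <- r | P t) F t).
Proof.
by move=> h; elim/big_ind: _ => //; [apply: mon_ideal0 | apply: mon_idealD].
Qed.

Lemma sub_mon_ideal U V p : {subset U <= V} -> mon_ideal U p -> mon_ideal V p.
Proof. by move=> h; apply: sub_all. Qed.

Lemma eq_mon_ideal U V p : U =1 V -> mon_ideal U p = mon_ideal V p.
Proof. by move=> h; apply: eq_all. Qed.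

Lemma mon_idealMl U p q : upclosed U -> mon_ideal U q -> mon_ideal U (p * q).
Proof.
move=> up /allP hq; apply/allP => m /msuppM_le /allpairsP[[m1 m2] [/= _ h2 ->]].
by rewrite addmC; apply/up/hq.
Qed.

Lemma mon_idealZ U c p : mon_ideal U p -> mon_ideal U (c *: p).
Proof. by move=> /allP h; apply/allP => m /msuppZ_le /h. Qed.

Lemma mon_idealX U m : mon_ideal U 'X_[m] = U m.
Proof. by rewrite /mon_ideal msuppX /= andbT. Qed.

Lemma mon_ideal_restr Q p : mon_ideal Q (restr Q p).
Proof. by apply/allP => m; rewrite msupp_restr => /andP[]. Qed.

Lemma mon_ideal_restrW U Q p : mon_ideal U p -> mon_ideal U (restr Q p).
Proof.
by move=> /allP h; apply/allP => m; rewrite msupp_restr => /andP[_ /h].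
Qed.

(** Multiplication by ['X_[t]] translates the support, so the colon ideal by
    ['X_[t]] is cut out by a translate of [U]. *)
Lemma mon_idealMX U t p :
  mon_ideal U ('X_[t] * p) = mon_ideal (fun m => U (t + m)%MM) p.
Proof.
rewrite mulrC; apply/allP/allP => h m.
  by rewrite mcoeff_msupp -(mcoeffMX p t) -mcoeff_msupp => /h.
rewrite (perm_mem (msuppMX p t)) => /mapP[m' /h Um ->].
by [].
Qed.

Definition generated (gens : seq mon) : pred mon :=
  fun m => has (fun t => t <= m)%MM gens.

Lemma generated_up gens : upclosed (generated gens).
Proof.
move=> m m' /hasP[t tg tm]; apply/hasP; exists t => //.
exact: lepm_trans tm (lem_addr _ _).
Qed.

Lemma ideal_spanX (T : finType) (D : pred T) (e : T -> mon) f :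
  ideal_span D (fun t => 'X_[e t] : S) f <->
  mon_ideal (generated [seq e t | t <- enum D]) f.
Proof.
split=> [[c ->]|/allP h].
  apply: mon_ideal_sum => t Dt; apply: mon_idealMl; first exact: generated_up.
  rewrite mon_idealX; apply/hasP; exists (e t); last exact: lepm_refl.
  by apply: map_f; rewrite mem_enum.
pose g m := [pick t | D t && (e t <= m)%MM].
exists (fun t => \sum_(m <- msupp f | g m == Some t) f@_m *: 'X_[m - e t]).
rewrite {1}(mpolyE f).
under [RHS]eq_bigr => t _ do rewrite big_distrl /= big_mkcond /=.
rewrite exchange_big /= big_seq [RHS]big_seq; apply: eq_bigr => m mf.
rewrite /g; case: pickP => [t /andP[Dt le]|no]; last first.
  have /hasP[t] := h m mf; case/mapP => t'; rewrite mem_enum => Dt' -> le.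
  by have := no t'; rewrite le andbT -topredE /= in Dt' *; rewrite Dt'.
rewrite (bigD1 t) //= eqxx big1 ?addr0.
  by rewrite -scalerAl -mpolyXD submK.
move=> t' /andP[_ ne]; case: eqP => // -[] e'.
by rewrite e' eqxx in ne.
Qed.

End Monomials.

(** * Homogeneous matrices *)

Section GradedMatrices.
Variables (k : fieldType) (N : nat).
Local Notation S := {mpoly k[N]}.
Local Notation mon := 'X_{1..N}.

(** Matrix of a degree-preserving map between graded free modules whose basis
    vectors sit in the degrees [r] (source, rows) and [c] (target, columns). *)
Definition graded_mx m n (r : 'I_m -> int) (c : 'I_n -> int) (A : 'M[S]_(m, n)) :=
  forall i j, {in msupp (A i j), forall t : mon, (mdeg t)%:Z + c j = r i}.

Definition entries_in m n (V : pred mon) (A : 'M[S]_(m, n)) :=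
  forall i j, mon_ideal V (A i j).

Definition graded_part m n (r : 'I_m -> int) (c : 'I_n -> int)
    (A : 'M[S]_(m, n)) : 'M[S]_(m, n) :=
  \matrix_(i, j) restr (fun t : mon => (mdeg t)%:Z + c j == r i) (A i j).

Lemma graded_part_graded m n r c (A : 'M[S]_(m, n)) : graded_mx r c (graded_part r c A).
Proof. by move=> i j t; rewrite mxE msupp_restr => /andP[/eqP]. Qed.

Lemma graded_part_id m n r c (A : 'M[S]_(m, n)) :
  graded_mx r c A -> graded_part r c A = A.
Proof.
move=> h; apply/matrixP => i j; rewrite mxE restr_id //.
by apply/allP => t /h ->.
Qed.

Lemma graded_partM m n p r c c' (Z : 'M[S]_(m, n)) (D : 'M[S]_(n, p)) :
  graded_mx c' c D -> graded_part r c (Z *m D) = graded_part r c' Z *m D.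
Proof.
move=> h; apply/matrixP => i l; rewrite !mxE raddf_sum /=.
apply: eq_bigr => j _; rewrite mxE; apply: restrM => t t' /h <-.
by rewrite mdegD PoszD addrA.
Qed.

Lemma graded_mxM m n p r c c' (A : 'M[S]_(m, n)) (D : 'M[S]_(n, p)) :
  graded_mx r c' A -> graded_mx c' c D -> graded_mx r c (A *m D).
Proof.
move=> hA hD; rewrite -(graded_part_id hA) -(graded_partM _ _ hD).
exact: graded_part_graded.
Qed.

Lemma graded_mxN m n r c (A : 'M[S]_(m, n)) : graded_mx r c A -> graded_mx r c (- A).
Proof. by move=> hA i j t; rewrite mxE (perm_mem (msuppN _)) => /hA. Qed.

Lemma graded_mx0 m n r c : graded_mx r c (0 : 'M[S]_(m, n)).
Proof. by move=> i j t; rewrite mxE msupp0. Qed.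

Lemma graded_mx_scalar m (r c : 'I_m -> int) t :
  (forall i, (mdeg t)%:Z + c i = r i) -> graded_mx r c ('X_[t]%:M : 'M[S]_m).
Proof.
move=> h i j u; rewrite mxE; case: eqP => [->|_].
  by rewrite mulr1n msuppX inE => /eqP ->.
by rewrite mulr0n msupp0.
Qed.

Definition dgD m n (r : 'I_m -> int) (s : 'I_n -> int) (i : 'I_(m + n)) : int :=
  match split i with inl i1 => r i1 | inr i2 => s i2 end.

Lemma dgDl m n (r : 'I_m -> int) (s : 'I_n -> int) i :
  dgD r s (lshift n i) = r i.
Proof. by rewrite /dgD (unsplitK (inl i)). Qed.

Lemma dgDr m n (r : 'I_m -> int) (s : 'I_n -> int) i :
  dgD r s (rshift m i) = s i.
Proof. by rewrite /dgD (unsplitK (inr i)). Qed.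

Lemma graded_mx_row m n1 n2 r c1 c2 (A : 'M[S]_(m, n1)) (B : 'M[S]_(m, n2)) :
  graded_mx r c1 A -> graded_mx r c2 B -> graded_mx r (dgD c1 c2) (row_mx A B).
Proof.
move=> hA hB i j; case: (splitP j) => l e.
  by have -> : j = lshift n2 l by [apply: val_inj]; rewrite row_mxEl dgDl; apply: hA.
by have -> : j = rshift n1 l by [apply: val_inj]; rewrite row_mxEr dgDr; apply: hB.
Qed.

Lemma graded_mx_col m1 m2 n r1 r2 c (A : 'M[S]_(m1, n)) (B : 'M[S]_(m2, n)) :
  graded_mx r1 c A -> graded_mx r2 c B -> graded_mx (dgD r1 r2) c (col_mx A B).
Proof.
move=> hA hB j i; case: (splitP j) => l e.
  by have -> : j = lshift m2 l by [apply: val_inj]; rewrite col_mxEu dgDl; apply: hA.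
by have -> : j = rshift m1 l by [apply: val_inj]; rewrite col_mxEd dgDr; apply: hB.
Qed.

Lemma graded_mx_block m1 m2 n1 n2 r1 r2 c1 c2
    (A : 'M[S]_(m1, n1)) B C (D : 'M[S]_(m2, n2)) :
  graded_mx r1 c1 A -> graded_mx r1 c2 B -> graded_mx r2 c1 C -> graded_mx r2 c2 D ->
  graded_mx (dgD r1 r2) (dgD c1 c2) (block_mx A B C D).
Proof. by move=> *; apply: graded_mx_col; apply: graded_mx_row. Qed.

Lemma entries_in_mulr m n p V (A : 'M[S]_(m, n)) (B : 'M[S]_(n, p)) :
  upclosed V -> entries_in V B -> entries_in V (A *m B).
Proof.
by move=> up h i j; rewrite mxE; apply: mon_ideal_sum => l _; apply: mon_idealMl.
Qed.

Lemma entries_inT m n (A : 'M[S]_(m, n)) : entries_in predT A.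
Proof. by move=> i j; rewrite /mon_ideal all_predT. Qed.

Lemma upclosedT : @upclosed N predT.
Proof. by []. Qed.

(** With this property of the differentials of a target complex, lifts into it
    can be chosen with all their entries in the ideal of [V]. *)
Definition lifts_in V m n (D : 'M[S]_(m, n)) := forall p (Z : 'M[S]_(p, m)),
  entries_in V (Z *m D) -> exists2 Z', entries_in V Z' & Z' *m D = Z *m D.

Lemma lifts_inT m n (D : 'M[S]_(m, n)) : lifts_in predT D.
Proof. by move=> p Z _; exists Z => //; apply: entries_inT. Qed.

Lemma rows_lift p m n (W : 'M[S]_(p, n)) (D : 'M[S]_(m, n)) :
  (forall i, exists z, row i W = z *m D) -> exists Z, W = Z *m D.
Proof.
move=> /fin_all_exists[z hz]; exists (\matrix_i z i).
by apply/row_matrixP => i; rewrite row_mul rowK.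
Qed.

(** The degree-preserving part of any lift is again a lift, because [D] and [W]
    preserve degrees; passing to it only removes monomials, so the entries stay
    in the ideal of [V]. *)
Lemma graded_lift V p m n r c' c (W : 'M[S]_(p, n)) (D : 'M[S]_(m, n)) :
  lifts_in V D -> graded_mx c' c D -> graded_mx r c W -> entries_in V W ->
  (forall i, exists z, row i W = z *m D) ->
  exists Z, [/\ graded_mx r c' Z, entries_in V Z & W = Z *m D].
Proof.
move=> lD hD hW vW /rows_lift[Z0 eW].
have [Z vZ eZ] : exists2 Z, entries_in V Z & Z *m D = Z0 *m D.
  by apply: lD; rewrite -eW.
exists (graded_part r c' Z); split.
- exact: graded_part_graded.
- by move=> i j; rewrite mxE; apply: mon_ideal_restrW.
- by rewrite -(graded_partM _ _ hD) eZ -eW graded_part_id.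
Qed.

End GradedMatrices.

(** * Complexes of graded free modules *)

(** Chain maps and homotopies are built degree by degree: each step needs the
    invariant [Q] of the previous one. *)
Lemma dependent_sequence (T : nat -> Type) (Q : forall i, T i -> Prop)
    (R : forall i, T i -> T i.+1 -> Prop) :
  (forall i x, Q i x -> exists y, Q i.+1 y /\ R i x y) ->
  forall x0, Q 0%N x0 ->
  exists2 f : forall i, T i, f 0%N = x0 &
    forall i, Q i (f i) /\ R i (f i) (f i.+1).
Proof.
move=> step x0 Q0.
pose next i (x : {x | Q i x}) :=
  constructive_indefinite_description _ (step i (sval x) (svalP x)).
pose f := nat_rect (fun i => {x | Q i x}) (exist _ x0 Q0)
  (fun i x => exist _ (sval (next i x)) (svalP (next i x)).1).
exists (fun i => sval (f i)) => // i; split; first exact: svalP.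
exact: (svalP (next i (f i))).2.
Qed.

Section Complexes.
Variables (k : fieldType) (N : nat).
Local Notation S := {mpoly k[N]}.
Local Notation mon := 'X_{1..N}.

(** The data of a complex of graded free modules in degrees [0, 1, ...],
    without augmentation, so that shifts, sums and cones stay of this form. *)
Record fcx := Fcx {
  crk : nat -> nat;
  cdg : forall i, 'I_(crk i) -> int;
  cdiff : forall i, 'M[S]_(crk i.+1, crk i)
}.
Implicit Types F G : fcx.

Definition graded_cx F := forall i, graded_mx (@cdg F i.+1) (@cdg F i) (cdiff F i).

(** Being an equivalence, this includes [d \o d = 0]. *)
Definition acyclic F := forall i (w : 'rV_(crk F i.+1)),
  w *m cdiff F i = 0 <-> exists z, w = z *m cdiff F i.+1.

Record resolves F (aug : 'cV[S]_(crk F 0)) (I : S -> Prop) : Prop := Resolves {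
  res_graded : graded_cx F;
  res_acyclic : acyclic F;
  res_aug_graded : graded_mx (@cdg F 0) (fun=> 0) aug;
  res_im : forall f, I f <-> exists w, w *m aug = f%:M;
  res_ker : forall w : 'rV_(crk F 0),
    w *m aug = 0 <-> exists z, w = z *m cdiff F 0
}.

Arguments resolves F aug I : clear implicits.

Lemma acyclic_dd F i : acyclic F -> cdiff F i.+1 *m cdiff F i = 0.
Proof.
move=> h; apply/row_matrixP => j; rewrite row_mul row0; apply/h.
by exists (delta_mx 0 j); rewrite -rowE.
Qed.

Lemma resolves_daug F aug I : resolves F aug I -> cdiff F 0 *m aug = 0.
Proof.
move=> h; apply/row_matrixP => j; rewrite row_mul row0; apply/(res_ker h).
by exists (delta_mx 0 j); rewrite -rowE.
Qed.

Lemma resolves_aug_in F aug I i : resolves F aug I -> I (aug i ord0).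
Proof.
move=> h; apply/(res_im (F := F) h); exists (delta_mx 0 i).
by rewrite -rowE [LHS]mx11_scalar mxE.
Qed.

Lemma eq_resolves F aug (I J : S -> Prop) :
  (forall f, I f <-> J f) -> resolves F aug I -> resolves F aug J.
Proof. by move=> e [h1 h2 h3 h4 h5]; split=> // f; rewrite -e. Qed.

(** ** Shifts, sums, suspensions and cones *)

Definition shift (e : int) F : fcx :=
  Fcx (fun i v => @cdg F i v + e) (cdiff F).

Lemma shift_graded e F : graded_cx F -> graded_cx (shift e F).
Proof. by move=> h i u v t /h /= <-; rewrite addrA. Qed.

Definition dsum F G : fcx :=
  @Fcx (fun i => crk F i + crk G i)%N (fun i => dgD (@cdg F i) (@cdg G i))
    (fun i => block_mx (cdiff F i) 0 0 (cdiff G i)).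

Lemma dsum_graded F G : graded_cx F -> graded_cx G -> graded_cx (dsum F G).
Proof.
by move=> hF hG i; apply: graded_mx_block; rewrite //; apply: graded_mx0.
Qed.

Lemma dsum_acyclic F G : acyclic F -> acyclic G -> acyclic (dsum F G).
Proof.
move=> hF hG i w; rewrite -[w]hsubmxK mul_row_block !mulmx0 addr0 add0r.
split=> [|[z]].
  rewrite -row_mx0 => /eq_row_mx[/hF[z1 ->] /hG[z2 ->]].
  by exists (row_mx z1 z2); rewrite mul_row_block !mulmx0 addr0 add0r.
rewrite -[z]hsubmxK mul_row_block !mulmx0 addr0 add0r => /eq_row_mx[e1 e2].
by rewrite e1 e2 -!mulmxA !acyclic_dd // !mulmx0 row_mx0.
Qed.

Definition susp_rk F i := if i is i'.+1 then crk F i' else 0%N.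

Definition susp F : fcx :=
  @Fcx (susp_rk F)
    (fun i => match i return 'I_(susp_rk F i) -> int with
              | 0 => fun=> 0 | i'.+1 => @cdg F i' end)
    (fun i => match i return 'M_(susp_rk F i.+1, susp_rk F i) with
              | 0 => 0 | i'.+1 => - cdiff F i' end).

Lemma susp_graded F : graded_cx F -> graded_cx (susp F).
Proof. by move=> h [|i] /=; [apply: graded_mx0 | apply: graded_mxN]. Qed.

(** The sign in the suspension makes the cone of a chain map a complex. *)
Definition cone F G (a : forall i, 'M[S]_(crk G i, crk F i)) : fcx :=
  @Fcx (fun i => crk F i + crk (susp G) i)%N
    (fun i => dgD (@cdg F i) (@cdg (susp G) i))
    (fun i => block_mx (cdiff F i) 0 (a i) (cdiff (susp G) i)).

Definition chain_map F G (a : forall i, 'M[S]_(crk G i, crk F i)) :=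
  forall i, cdiff G i *m a i = a i.+1 *m cdiff F i.

Definition graded_map F G (a : forall i, 'M[S]_(crk G i, crk F i)) :=
  forall i, graded_mx (@cdg G i) (@cdg F i) (a i).

Lemma cone_graded F G a :
  graded_cx F -> graded_cx G -> graded_map a -> graded_cx (@cone F G a).
Proof.
move=> hF hG ha i; apply: graded_mx_block => //; first exact: graded_mx0.
  exact: ha.
exact: (susp_graded hG).
Qed.

(** In the long exact sequence of the cone, the only possible homology in
    positive degrees is the kernel of [H_0(G) -> H_0(F)], which the last
    hypothesis makes zero. *)
Lemma cone_acyclic F G a :
  acyclic F -> acyclic G -> chain_map a ->
  (forall (z : 'rV_(crk G 0)) (y : 'rV_(crk F 1)),
    z *m a 0%N = y *m cdiff F 0 -> exists z', z = z' *m cdiff G 0) ->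
  acyclic (@cone F G a).
Proof.
move=> hF hG ha inj i w; split=> [|[w' ->]]; last first.
  rewrite -[w']hsubmxK !mul_row_block !mulmx0 !add0r /=.
  set y' := lsubmx w'; set z' := rsubmx w'.
  rewrite mulmxDl -!mulmxA acyclic_dd // mulmx0 add0r !mulNmx !mulmxN ha subrr.
  case: i {w} w' @y' @z' => [|i] w' y' z' /=.
    by rewrite !mulmx0 oppr0 row_mx0.
  by rewrite !mulmxN acyclic_dd // mulmx0 !oppr0 row_mx0.
rewrite -[w]hsubmxK mul_row_block mulmx0 add0r /=.
set y := lsubmx w; set z := rsubmx w.
rewrite -row_mx0 => /eq_row_mx[e1 e2].
have [z' ez] : exists z', z = z' *m cdiff G i.
  case: i w @y @z e1 e2 => [|i] w y z /= e1 e2.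
    by apply: (inj z (- y)); rewrite mulNmx; apply/eqP; rewrite -addr_eq0 addrC e1.
  by apply/hG; apply: oppr_inj; rewrite -mulmxN oppr0.
have [y' ey] : exists y', y + z' *m a i.+1 = y' *m cdiff F i.+1.
  by apply/hF; rewrite mulmxDl -mulmxA -ha mulmxA -ez.
exists (row_mx y' (- z')); rewrite mul_row_block mulmx0 add0r /=.
by rewrite -ey mulNmx mulmxN mulNmx opprK addrK -ez.
Qed.

(** [H_0] of the cone is the cokernel of [H_0(G) -> H_0(F)], which the
    hypotheses on [eps] identify with [I]. *)
Lemma cone_resolves F G a (eps : 'cV[S]_(crk F 0)) I :
  graded_cx F -> acyclic F -> graded_cx G -> acyclic G ->
  graded_map a -> chain_map a -> graded_mx (@cdg F 0) (fun=> 0) eps ->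
  (forall f, I f <-> exists w, w *m eps = f%:M) ->
  cdiff F 0 *m eps = 0 -> a 0%N *m eps = 0 ->
  (forall w : 'rV_(crk F 0), w *m eps = 0 ->
    exists y z, w = y *m cdiff F 0 + z *m a 0%N) ->
  (forall (z : 'rV_(crk G 0)) (y : 'rV_(crk F 1)),
    z *m a 0%N = y *m cdiff F 0 -> exists z', z = z' *m cdiff G 0) ->
  resolves (@cone F G a) (col_mx eps 0) I.
Proof.
move=> gF aF gG aG ga ca ge im de ae ker inj; split.
- exact: cone_graded.
- exact: cone_acyclic.
- by apply: graded_mx_col => // -[].
- move=> f; rewrite im; split=> [[w <-]|[w <-]].
    by exists (row_mx w 0); rewrite mul_row_col mul0mx addr0.
  by exists (lsubmx w); rewrite -[w in RHS]hsubmxK mul_row_col mulmx0 addr0.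
- move=> w; rewrite -[w]hsubmxK mul_row_col mulmx0 addr0.
  split=> [/ker[y [z e]]|[z]].
    exists (row_mx y z); rewrite mul_row_block /= -e.
    by congr row_mx; apply/matrixP => ? [].
  rewrite -[z]hsubmxK mul_row_block /= => /eq_row_mx[-> _].
  by rewrite mulmxDl -!mulmxA de ae !mulmx0 addr0.
Qed.

(** ** Lifting maps between ideals to chain maps *)

Lemma chain_lift V F G a0 :
  upclosed V -> graded_cx F -> (forall i, cdiff F i.+1 *m cdiff F i = 0) ->
  graded_cx G -> acyclic G -> (forall i, lifts_in V (cdiff G i)) ->
  graded_mx (@cdg F 0) (@cdg G 0) a0 -> entries_in V a0 ->
  (forall j, exists z, row j (cdiff F 0 *m a0) = z *m cdiff G 0) ->
  exists2 a : forall i, 'M[S]_(crk F i, crk G i), a 0%N = a0 &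
    [/\ graded_map a, chain_map a & forall i, entries_in V (a i)].
Proof.
move=> up gF cF gG aG lG ga va ra.
pose Q i (x : 'M[S]_(crk F i, crk G i)) :=
  [/\ graded_mx (@cdg F i) (@cdg G i) x, entries_in V x &
      forall j, exists z, row j (cdiff F i *m x) = z *m cdiff G i].
pose R i (x : 'M[S]_(crk F i, crk G i)) y := cdiff F i *m x = y *m cdiff G i.
have step i x : Q i x -> exists y, Q i.+1 y /\ R i x y.
  case=> gx vx rx.
  have [Z [gZ vZ eZ]] := graded_lift (lG i) (gG i) (graded_mxM (gF i) gx)
    (entries_in_mulr _ up vx) rx.
  exists Z; split=> //; split=> // j; rewrite row_mul; apply/aG.
  by rewrite -mulmxA -eZ mulmxA -row_mul cF row0 mul0mx.
have [|a e0 ha] := dependent_sequence step (x0 := a0); first by split.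
by exists a => //; split=> i; have [[? ? ?] ?] := ha i.
Qed.

(** For [t = 0] this lifts an inclusion [I <= J]. If all products ['X_[t] * f]
    lie in the ideal of [V] as well, so do the entries of the lift. *)
Lemma resolution_lift V t F aF (I : S -> Prop) G aG (J : S -> Prop) :
  upclosed V -> resolves F aF I -> resolves G aG J ->
  (forall f, I f -> J ('X_[t] * f)) ->
  lifts_in V aG -> (forall i, lifts_in V (cdiff G i)) ->
  (forall f, I f -> mon_ideal V ('X_[t] * f)) ->
  exists a : forall i, 'M[S]_(crk F i, crk G i),
    [/\ graded_map (F := G) (G := shift (mdeg t)%:Z F) a, chain_map a,
        forall i, entries_in V (a i) & a 0%N *m aG = 'X_[t] *: aF].
Proof.
move=> up rF rG sIJ l0 lG vI.
have [||i|a0 [g0 v0 e0]] := graded_lift (r := @cdg (shift (mdeg t)%:Z F) 0)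
  (W := 'X_[t] *: aF) l0 (res_aug_graded rG).
- move=> i j m; rewrite mxE mulrC (perm_mem (msuppMX _ _)) => /mapP[m' h ->].
  by rewrite mdegD PoszD addr0 /= -(res_aug_graded rF h) addr0 addrC.
- by move=> i j; rewrite mxE ord1; apply/vI/(resolves_aug_in _ rF).
- have /(res_im rG)[w hw] := sIJ _ (resolves_aug_in (F := F) i rF).
  by exists w; rewrite hw [LHS]mx11_scalar !mxE.
have [j|a ea [ga ca va]] :=
  chain_lift up (shift_graded (e := (mdeg t)%:Z) (res_graded rF))
  (fun i => acyclic_dd i (res_acyclic rF)) (res_graded rG) (res_acyclic rG)
  lG g0 v0.
  rewrite row_mul; apply/(res_ker rG).
  by rewrite -mulmxA -e0 -scalemxAr -row_mul (resolves_daug rF) row0 scaler0.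
by exists a; split=> //; rewrite ea -e0.
Qed.

(** Over the exact target, the error [a i.+1 - d h] of the homotopy built so far
    is a cycle, hence a boundary. *)
Lemma null_homotopy F aF (I : S -> Prop) (a : forall i, 'M[S]_(crk F i, crk F i)) :
  resolves F aF I -> chain_map a -> a 0%N *m aF = 0 ->
  exists h : forall i, 'M[S]_(crk F i, crk F i.+1),
    a 0%N = h 0%N *m cdiff F 0 /\
    forall i, a i.+1 = cdiff F i *m h i + h i.+1 *m cdiff F i.+1.
Proof.
move=> rF ca a0.
have [|h0 e0] := @rows_lift _ _ _ _ _ (a 0%N) (cdiff F 0).
  by move=> j; apply/(res_ker rF); rewrite -row_mul a0 row0.
pose Q i : 'M[S]_(crk F i, crk F i.+1) -> Prop :=
  fun x => cdiff F i *m a i = cdiff F i *m x *m cdiff F i.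
pose R i (x : 'M[S]_(crk F i, crk F i.+1)) y :=
  a i.+1 = cdiff F i *m x + y *m cdiff F i.+1.
have step i x : Q i x -> exists y, Q i.+1 y /\ R i x y.
  move=> qx.
  have [|y ey] := @rows_lift _ _ _ _ _ (a i.+1 - cdiff F i *m x) (cdiff F i.+1).
    move=> j; apply/(res_acyclic rF).
    by rewrite -row_mul mulmxBl -ca qx subrr row0.
  have e : a i.+1 = cdiff F i *m x + y *m cdiff F i.+1 by rewrite -ey subrKC.
  exists y; split; last exact: e.
  rewrite /Q {1}e mulmxDr !mulmxA acyclic_dd ?mul0mx ?add0r //.
  exact: res_acyclic rF.
have [|h eh hh] := dependent_sequence step (x0 := h0).
  by rewrite /Q -mulmxA -e0.
by exists h; rewrite eh; split=> // i; have [] := hh i.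
Qed.

End Complexes.

Arguments resolves {k N} F aug I.

(** * Betti numbers computed from complexes *)

Section TorDimension.
Variables (k : fieldType) (N : nat).
Local Notation S := {mpoly k[N]}.
Local Notation fcx := (fcx k N).
Implicit Types F G : fcx.

(** A projector whose row space is the degree-[j] part of [F_i (x) k]. *)
Definition deg_part F i j : 'M[k]_(crk F i) :=
  diag_mx (\row_v (@cdg _ _ F i v == j)%:R).

Definition kdiff F i : 'M[k]_(crk F i.+1, crk F i) :=
  map_mx (mcoeff 0%MM) (cdiff F i).

Definition bdim F i j := \rank (deg_part F i.+1 j *m kdiff F i).

Definition at_pred (b : nat -> nat) i := if i is i'.+1 then b i' else 0%N.

(** [dim H_i(F (x) k)_j] rewritten by rank-nullity: ranks, unlike intersections
    with kernels, are additive on block diagonal matrices. *)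
Definition tordim F i j : nat :=
  (\rank (deg_part F i j) - at_pred (bdim F ^~ j) i - bdim F i j)%N.

Definition cycles F i j : 'M[k]_(crk F i) :=
  match i return 'M[k]_(crk F i) with
  | 0 => deg_part F 0 j
  | i'.+1 => (deg_part F i'.+1 j :&: kermx (kdiff F i'))%MS
  end.

Lemma rank_cycles F i j :
  \rank (cycles F i j) = (\rank (deg_part F i j) - at_pred (bdim F ^~ j) i)%N.
Proof.
case: i => [|i] /=; first by rewrite subn0.
by rewrite /bdim -(mxrank_mul_ker (deg_part F i.+1 j) (kdiff F i)) addKn.
Qed.

Lemma tordimE F i j :
  tordim F i j = (\rank (cycles F i j) - \rank (deg_part F i.+1 j *m kdiff F i))%N.
Proof. by rewrite rank_cycles. Qed.

Lemma deg_part_graded_mx m n (r : 'I_m -> int) (c : 'I_n -> int) (A : 'M[S]_(m, n)) j :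
  graded_mx r c A ->
  diag_mx (\row_v (r v == j)%:R) *m map_mx (mcoeff 0%MM) A =
  map_mx (mcoeff 0%MM) A *m diag_mx (\row_v (c v == j)%:R).
Proof.
move=> h; rewrite mul_diag_mx mul_mx_diag; apply/matrixP => u v; rewrite !mxE.
case: (eqVneq (A u v)@_0%MM 0) => [->|]; first by rewrite mulr0 mul0r.
by rewrite -mcoeff_msupp => /h; rewrite mdeg0 add0r => ->; rewrite mulrC.
Qed.

Lemma deg_part_kdiff F i j : graded_cx F ->
  deg_part F i.+1 j *m kdiff F i = kdiff F i *m deg_part F i j.
Proof. by move=> h; apply: deg_part_graded_mx. Qed.

Lemma deg_part_idem F i j : deg_part F i j *m deg_part F i j = deg_part F i j.
Proof.
rewrite mul_diag_mx; apply/matrixP => u v; rewrite !mxE.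
by case: eqP; rewrite ?mul1r // mul0r mul0rn.
Qed.

Lemma kdiff_kdiff F i : acyclic F -> kdiff F i.+1 *m kdiff F i = 0.
Proof. by move=> h; rewrite -map_mxM acyclic_dd // map_mx0. Qed.

Lemma boundaries_sub_cycles F i j : graded_cx F -> acyclic F ->
  (deg_part F i.+1 j *m kdiff F i <= cycles F i j)%MS.
Proof.
move=> gF aF.
have sub : (deg_part F i.+1 j *m kdiff F i <= deg_part F i j)%MS.
  by rewrite deg_part_kdiff // submxMl.
case: i sub => [|i] sub //=.
by rewrite sub_capmx sub; apply/sub_kermxP; rewrite -mulmxA kdiff_kdiff ?mulmx0.
Qed.

Lemma tordim_sum F i j : graded_cx F -> acyclic F ->
  (tordim F i j + bdim F i j + at_pred (bdim F ^~ j) i)%N = \rank (deg_part F i j).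
Proof.
move=> gF aF; have := mxrankS (boundaries_sub_cycles i j gF aF).
rewrite rank_cycles /tordim /bdim => le; rewrite subnK // subnK //.
by case: i {le} => [|i] //=; rewrite /bdim; apply: mxrankM_maxl.
Qed.

(** ** Independence of the resolution *)

(** [A] induces a map [Z / B -> Z' / B'], which is injective because [A']
    inverts it modulo [B]. *)
Lemma leq_rank_quotient m n p q r s (Z : 'M[k]_(p, m)) (B : 'M[k]_(q, m))
    (Z' : 'M[k]_(r, n)) (B' : 'M[k]_(s, n)) (A : 'M[k]_(m, n)) A' :
  (B <= Z)%MS -> (B' <= Z')%MS -> (Z *m A <= Z')%MS -> (B' *m A' <= B)%MS ->
  (Z *m (A *m A' - 1%:M) <= B)%MS ->
  (\rank Z - \rank B <= \rank Z' - \rank B')%N.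
Proof.
move=> sBZ sB'Z' sZ sB' sE.
have kerB l (X : 'M[k]_(l, m)) : (X <= B)%MS = (X *m cokermx B == 0).
  exact: submxE.
have -> : (\rank Z - \rank B)%N = \rank (Z *m cokermx B).
  rewrite -(mxrank_mul_ker Z (cokermx B)).
  suff -> : \rank (Z :&: kermx (cokermx B))%MS = \rank B by rewrite addnK.
  apply: eqmx_rank; rewrite sub_capmx sBZ /= sub_kermx mulmx_coker eqxx andbT.
  by rewrite kerB -sub_kermx capmxSr.
have -> : Z *m cokermx B = Z *m A *m (A' *m cokermx B).
  move: sE; rewrite kerB mulmxBr mulmx1 mulmxBl subr_eq0 => /eqP <-.
  by rewrite !mulmxA.
apply: leq_trans (mxrankS (submxMr _ sZ)) _.
rewrite -(mxrank_mul_ker Z' (A' *m cokermx B)) -addnBA ?leq_addr //.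
apply: mxrankS; rewrite sub_capmx sB'Z' sub_kermx mulmxA.
by rewrite -kerB.
Qed.

(** A homotopy inverse shows that a comparison map between two resolutions of
    [I] is injective on the homology modulo the variables. *)
Lemma tordim_le F aF G aG (I : S -> Prop) i j :
  resolves F aF I -> resolves G aG I -> (tordim F i j <= tordim G i j)%N.
Proof.
have lift F1 a1 F2 a2 : resolves F1 a1 I -> resolves F2 a2 I ->
    exists a : forall i, 'M[S]_(crk F1 i, crk F2 i),
      [/\ graded_map a, chain_map a & a 0%N *m a2 = a1].
  move=> r1 r2.
  have sII f : I f -> I ('X_[0] * f) by rewrite mpolyX0 mul1r.
  have predTI f : I f -> mon_ideal predT ('X_[0] * f).
    by rewrite /mon_ideal all_predT.
  have [a [ga ca _ a0]] := resolution_lift (@upclosedT N) r1 r2 sII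
    (@lifts_inT _ _ _ _ _) (fun l => @lifts_inT _ _ _ _ _) predTI.
  exists a; split=> //; last by rewrite a0 mpolyX0 scale1r.
  by move=> l u v m /(ga l) ->; rewrite /= mdeg0 addr0.
move=> rF rG; have [a [ga ca a0]] := lift _ _ _ _ rF rG.
have [b [gb cb b0]] := lift _ _ _ _ rG rF.
have [||h [h0 hS]] := @null_homotopy _ _ F aF I (fun l => a l *m b l - 1%:M) rF.
- by move=> l; rewrite mulmxBr mulmxBl mulmxA ca -!mulmxA cb mulmx1 mul1mx.
- by rewrite mulmxBl -mulmxA b0 a0 mul1mx subrr.
have [gF aF' gG aG'] :=
  And4 (res_graded rF) (res_acyclic rF) (res_graded rG) (res_acyclic rG).
pose kmap F1 F2 (x : forall i, 'M[S]_(crk F1 i, crk F2 i)) l :=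
  map_mx (mcoeff 0%MM) (x l).
have kca l : kdiff F l *m kmap _ _ a l = kmap _ _ a l.+1 *m kdiff G l.
  by rewrite -!map_mxM ca.
have kcb l : kdiff G l *m kmap _ _ b l = kmap _ _ b l.+1 *m kdiff F l.
  by rewrite -!map_mxM cb.
have pa l : deg_part F l j *m kmap _ _ a l = kmap _ _ a l *m deg_part G l j.
  by apply: deg_part_graded_mx; apply: ga.
have pb l : deg_part G l j *m kmap _ _ b l = kmap _ _ b l *m deg_part F l j.
  by apply: deg_part_graded_mx; apply: gb.
have ka_cycles l : (cycles F l j *m kmap _ _ a l <= cycles G l j)%MS.
  case: l => [|l] /=; first by rewrite pa submxMl.
  rewrite sub_capmx; apply/andP; split.
    apply: submx_trans (submxMr _ (capmxSl _ _)) _.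
    by rewrite pa submxMl.
  apply/sub_kermxP; rewrite -mulmxA -kca mulmxA.
  have /sub_kermxP -> := capmxSr (deg_part F l.+1 j) (kermx (kdiff F l)).
  by rewrite mul0mx.
rewrite !tordimE; apply: (leq_rank_quotient (A := kmap _ _ a i) (A' := kmap _ _ b i)).
- exact: boundaries_sub_cycles.
- exact: boundaries_sub_cycles.
- exact: ka_cycles.
- by rewrite -mulmxA kcb mulmxA pb -mulmxA submxMl.
have e : kmap _ _ a i *m kmap _ _ b i - 1%:M =
    map_mx (mcoeff 0%MM) (a i *m b i - 1%:M).
  by rewrite map_mxB map_mxM map_mx1.
(* On cycles of degree [j] the homotopy leaves only its boundary term, whose
   degree-[j] part is the image of a degree-[j] chain. *)
have [x ex] : exists x, cycles F i j *m (kmap _ _ a i *m kmap _ _ b i - 1%:M) =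
    x *m kdiff F i.
  rewrite e; case: i {e} => [|i] /=.
    rewrite h0 map_mxM mulmxA; eexists; reflexivity.
  rewrite hS map_mxD !map_mxM mulmxDr !mulmxA.
  have /sub_kermxP -> := capmxSr (deg_part F i.+1 j) (kermx (kdiff F i)).
  rewrite !mul0mx add0r; eexists; reflexivity.
have cycles_deg_part : cycles F i j *m deg_part F i j = cycles F i j.
  have /submxP[D ->] : (cycles F i j <= deg_part F i j)%MS.
    by case: (i) => [|l] //=; apply: capmxSl.
  by rewrite -mulmxA deg_part_idem.
rewrite -cycles_deg_part -mulmxA mulmxBr mulmxA pa -mulmxA pb mulmxA.
rewrite mulmx1 -{2}[deg_part F i j]mul1mx -mulmxBl mulmxA ex.
by rewrite -mulmxA -deg_part_kdiff // submxMl.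
Qed.

Lemma tordim_unique F aF G aG (I : S -> Prop) i j :
  resolves F aF I -> resolves G aG I -> tordim F i j = tordim G i j.
Proof.
move=> rF rG; apply/eqP; rewrite eqn_leq.
by rewrite (tordim_le _ _ rF rG) (tordim_le _ _ rG rF).
Qed.

Lemma mx11_eq (A : 'M[S]_1) f : A ord0 ord0 = f <-> A = f%:M.
Proof.
split=> [<-|->]; first exact: mx11_scalar.
by rewrite mxE eqxx mulr1n.
Qed.

Definition fcx_of (I : S -> Prop) (R : graded_free_resolution I) : fcx :=
  Fcx (@dg _ _ _ R) (diff R).

Lemma fcx_of_resolves (I : S -> Prop) (R : graded_free_resolution I) :
  resolves (fcx_of R) (aug R) I.
Proof.
split.
- exact: diff_homog.
- exact: diff_ker.
- by move=> u v m; rewrite ord1 addr0; apply: aug_homog.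
- by move=> f; rewrite (aug_im R f); split=> -[w /mx11_eq]; exists w.
- exact: aug_ker.
Qed.

Lemma tor_dim_fcx_of (I : S -> Prop) (R : graded_free_resolution I) i j :
  tor_dim R i j = tordim (fcx_of R) i j.
Proof. by rewrite tordimE; case: i. Qed.

(** The set of values from which [betti] is chosen is a singleton. *)
Lemma betti_tordim F aF (I : S -> Prop) i j :
  resolves F aF I -> betti I i%:Z j = tordim F i j.
Proof.
move=> rF.
have ah u : {in msupp (aF u ord0), forall t, (mdeg t)%:Z = @cdg _ _ F 0 u}.
  by move=> t /(res_aug_graded rF); rewrite addr0.
have ai f : I f <-> exists w : 'rV_(crk F 0), (w *m aF) ord0 ord0 = f.
  by rewrite (res_im rF f); split=> -[w /mx11_eq]; exists w.
pose R := GradedFreeResolution ah (res_graded rF) ai (res_ker rF) (res_acyclic rF).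
have [R' <-] : exists R' : graded_free_resolution I,
    tor_dim R' i j = betti I i%:Z j.
  apply: (epsilon_spec (inhabits 0%N)
    (fun b => exists R' : graded_free_resolution I, tor_dim R' i j = b)).
  by exists (tor_dim R i j), R.
rewrite tor_dim_fcx_of.
exact: (tordim_unique i j (fcx_of_resolves R') rF).
Qed.

(** ** Betti numbers of shifts, sums and cones *)

Lemma tordim_shift e F i j : tordim (shift e F) i j = tordim F i (j - e).
Proof.
have pe l : deg_part (shift e F) l j = deg_part F l (j - e).
  apply/matrixP => u v; rewrite !mxE /=.
  by rewrite [in RHS]eq_sym subr_eq eq_sym.
by rewrite /tordim /bdim !pe; case: i => [|i] //=; rewrite pe.
Qed.

Lemma bdim_susp F i j : bdim (susp F) i j = at_pred (bdim F ^~ j) i.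
Proof.
case: i => [|i] /=; first by rewrite /bdim /kdiff /= map_mx0 mulmx0 mxrank0.
by rewrite /bdim /kdiff /= map_mxN mulmxN mxrank_opp.
Qed.

Lemma deg_part_dgD m n (r : 'I_m -> int) (s : 'I_n -> int) j :
  diag_mx (\row_v (dgD r s v == j)%:R) =
  block_mx (diag_mx (\row_v (r v == j)%:R)) 0 0 (diag_mx (\row_v (s v == j)%:R))
  :> 'M[k]_(m + n).
Proof.
rewrite -diag_mx_row; congr diag_mx; apply/rowP => v; rewrite !mxE /dgD.
by case: split => l; rewrite mxE.
Qed.

Lemma rank_deg_part_susp F i j :
  \rank (deg_part (susp F) i j) = at_pred (fun l => \rank (deg_part F l j)) i.
Proof. by case: i => [|i] //=; rewrite [deg_part _ _ _]flatmx0 mxrank0. Qed.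

(** When the chain map vanishes modulo the variables, the differentials of the
    cone become block diagonal over the residue field. *)
Lemma tordim_cone F G a i j :
  graded_cx F -> acyclic F -> graded_cx G -> acyclic G ->
  (forall i, map_mx (mcoeff 0%MM) (a i) = 0) ->
  tordim (@cone _ _ F G a) i j = (tordim F i j + at_pred (tordim G ^~ j) i)%N.
Proof.
move=> gF aF gG aG a0.
have rp l : \rank (deg_part (cone a) l j) =
    (\rank (deg_part F l j) + at_pred (fun l => \rank (deg_part G l j)) l)%N.
  by rewrite -rank_deg_part_susp /deg_part /= deg_part_dgD rank_diag_block_mx.
have bp l : bdim (cone a) l j = (bdim F l j + at_pred (bdim G ^~ j) l)%N.
  rewrite -bdim_susp /bdim /deg_part /kdiff /= deg_part_dgD map_block_mx a0 map_mx0.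
  by rewrite mulmx_block !mulmx0 !mul0mx !addr0 add0r rank_diag_block_mx.
rewrite {1}/tordim rp bp -tordim_sum //.
case: i => [|i] /=; first by rewrite !addn0 subn0 addnK.
by rewrite bp -(tordim_sum i _ gG aG); case: i => [|i] /=; lia.
Qed.

Lemma tordim_dsum F G i j :
  graded_cx F -> acyclic F -> graded_cx G -> acyclic G ->
  tordim (dsum F G) i j = (tordim F i j + tordim G i j)%N.
Proof.
move=> gF aF gG aG.
have rp l : \rank (deg_part (dsum F G) l j) =
    (\rank (deg_part F l j) + \rank (deg_part G l j))%N.
  by rewrite /deg_part /= deg_part_dgD rank_diag_block_mx.
have bp l : bdim (dsum F G) l j = (bdim F l j + bdim G l j)%N.
  rewrite /bdim /deg_part /kdiff /= deg_part_dgD map_block_mx !map_mx0.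
  by rewrite mulmx_block !mulmx0 !mul0mx !addr0 add0r rank_diag_block_mx.
rewrite {1}/tordim rp bp -!tordim_sum //.
by case: i => [|i] /=; rewrite ?bp; lia.
Qed.

End TorDimension.

(** * Resolutions of monomial ideals by mapping cones *)

Section MonomialResolutions.
Variables (k : fieldType) (N : nat).
Local Notation S := {mpoly k[N]}.
Local Notation mon := 'X_{1..N}.
Local Notation fcx := (fcx k N).

Section Cone.
Variables (U U1 U2 J : pred mon) (t : mon).
Hypothesis defU : forall m, U m = (t <= m)%MM && U1 (m - t)%MM || U2 m.
Hypothesis defJ : forall m, J m = U1 m && U2 (t + m)%MM.
Variables (F1 F2 G : fcx).
Variables (a1 : 'cV[S]_(crk F1 0)) (a2 : 'cV[S]_(crk F2 0)) (aG : 'cV[S]_(crk G 0)).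
Hypothesis r1 : resolves F1 a1 (mon_ideal U1).
Hypothesis r2 : resolves F2 a2 (mon_ideal U2).
Hypothesis rG : resolves G aG (mon_ideal J).
Local Notation e := (mdeg t)%:Z.
Variables (a : forall i, 'M[S]_(crk G i, crk F1 i)).
Variables (b : forall i, 'M[S]_(crk G i, crk F2 i)).
Hypothesis ga : graded_map (F := F1) (G := G) a.
Hypothesis ca : chain_map (F := F1) (G := G) a.
Hypothesis a0 : a 0%N *m a1 = aG.
Hypothesis gb : graded_map (F := F2) (G := shift e G) b.
Hypothesis cb : chain_map (F := F2) (G := G) b.
Hypothesis b0 : b 0%N *m a2 = 'X_[t] *: aG.

Let F := dsum (shift e F1) F2.
Let c i : 'M[S]_(crk (shift e G) i, crk F i) := row_mx (a i) (- b i).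
Let eps : 'cV[S]_(crk F 0) := col_mx ('X_[t] *: a1) a2.

Lemma mon_cone_im f : mon_ideal U f <-> exists w, w *m eps = f%:M.
Proof.
split=> [Uf|[w]].
  pose Q := [pred m : mon | (t <= m)%MM && U1 (m - t)%MM].
  have [w1 h1] : exists w, w *m ('X_[t] *: a1) = (restr Q f)%:M.
    pose g := \sum_(m <- msupp f | Q m) f@_m *: 'X_[m - t].
    have /(res_im r1)[w hw] : mon_ideal U1 g.
      apply: mon_ideal_sum => m /andP[_ U1m]; apply: mon_idealZ.
      by rewrite mon_idealX.
    exists w; rewrite -scalemxAr hw scale_scalar_mx; congr (_%:M).
    rewrite /restr mulr_sumr; apply: eq_bigr => m /andP[tm _].
    by rewrite -scalerAr -mpolyXD addmC submK.
  have /(res_im r2)[w2 h2] : mon_ideal U2 (restr (predC Q) f).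
    apply/allP => m; rewrite msupp_restr => /andP[nQ mf].
    have := allP Uf m mf; rewrite defU => /orP[Qm|//].
    by rewrite /= Qm in nQ.
  exists (row_mx w1 w2); rewrite mul_row_col h1 h2 -raddfD /=.
  by rewrite restrC.
rewrite -[w]hsubmxK mul_row_col -scalemxAr => /mx11_eq <-.
rewrite !mxE; apply: mon_idealD.
  rewrite mon_idealMX; apply: (@sub_mon_ideal _ _ U1) => [m U1m|].
    by rewrite unfold_in defU lem_addr [(t + m)%MM]addmC addmK [U1 m]U1m.
  by apply/(res_im r1); exists (lsubmx w); apply/mx11_eq; rewrite mxE.
apply: (@sub_mon_ideal _ _ U2) => [m U2m|].
  by rewrite unfold_in defU [U2 m]U2m orbT.
by apply/(res_im r2); exists (rsubmx w); apply/mx11_eq; rewrite mxE.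
Qed.

(** The ideal of [U] is ['X_[t] * U1 + U2], and a relation between the two
    summands is given by an element of [J = U1 :&: (U2 : 'X_[t])]: the sequence
    [0 -> J -> U1 (+) U2 -> U -> 0] is exact, up to shifts. *)
Lemma mon_cone_resolves :
  resolves (@cone _ _ F (shift e G) c) (col_mx eps 0) (mon_ideal U).
Proof.
have [gF aF] : graded_cx F /\ acyclic F.
  split; first by apply: dsum_graded; [exact: shift_graded (res_graded r1) |
    exact: res_graded r2].
  by apply: dsum_acyclic; [exact: res_acyclic r1 | exact: res_acyclic r2].
apply: cone_resolves => //.
- exact: shift_graded (res_graded rG).
- exact: res_acyclic rG.
- move=> i; apply: graded_mx_row; last by apply: graded_mxN; exact: gb.
  by move=> u v m /ga /= <-; rewrite addrA.
- move=> i; rewrite /c /= mul_mx_row mul_row_block !mulmx0 addr0 add0r.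
  by rewrite ca mulmxN cb mulNmx.
- apply: graded_mx_col; last exact: res_aug_graded r2.
  move=> i j m; rewrite mxE mulrC (perm_mem (msuppMX _ _)) => /mapP[m' h ->].
  by rewrite mdegD PoszD addr0 /= -(res_aug_graded r1 h) addr0 addrC.
- exact: mon_cone_im.
- rewrite /F /= mul_block_col !mul0mx addr0 add0r -scalemxAr.
  by rewrite (resolves_daug r1) (resolves_daug r2) scaler0 col_mx0.
- by rewrite /c mul_row_col -scalemxAr a0 mulNmx b0 subrr.
- move=> w; rewrite -[w]hsubmxK mul_row_col -scalemxAr.
  set w1 := lsubmx w; set w2 := rsubmx w => e0.
  pose f1 := (w1 *m a1) ord0 ord0.
  have e1 : w1 *m a1 = f1%:M by apply/mx11_eq.
  have e2 : w2 *m a2 = (- ('X_[t] * f1))%:M.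
    apply/eqP; rewrite raddfN /= -scale_scalar_mx -e1 -addr_eq0 addrC.
    by rewrite e0.
  have U1f : mon_ideal U1 f1 by apply/(res_im r1); exists w1.
  have : mon_ideal U2 ('X_[t] * f1).
    by rewrite -mon_idealN; apply/(res_im r2); exists w2.
  rewrite mon_idealMX => U2f.
  have /(res_im rG)[z ez] : mon_ideal J f1.
    apply/allP => m mf; rewrite defJ.
    by rewrite (allP U1f m mf) (allP U2f m mf).
  have [y1 ey1] : exists y, w1 - z *m a 0%N = y *m cdiff F1 0.
    by apply/(res_ker r1); rewrite mulmxBl -mulmxA a0 ez e1 subrr.
  have [y2 ey2] : exists y, w2 + z *m b 0%N = y *m cdiff F2 0.
    apply/(res_ker r2); rewrite mulmxDl -mulmxA b0 -scalemxAr ez e2.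
    by rewrite scale_scalar_mx -raddfD /= addNr raddf0.
  exists (row_mx y1 y2), z; rewrite mul_row_block !mulmx0 addr0 add0r /=.
  by rewrite -ey1 -ey2 /c mul_mx_row add_row_mx subrK mulmxN addrK.
- move=> z y; rewrite -[y]hsubmxK /c mul_mx_row mul_row_block !mulmx0 addr0.
  move=> /eq_row_mx[e1 _]; apply/(res_ker rG).
  by rewrite -a0 mulmxA e1 -mulmxA (resolves_daug r1) mulmx0.
Qed.

Lemma tordim_mon_cone i j :
  (forall i, map_mx (mcoeff 0%MM) (a i) = 0) ->
  (forall i, map_mx (mcoeff 0%MM) (b i) = 0) ->
  tordim (@cone _ _ F (shift e G) c) i j =
  (tordim F1 i (j - e)%R + tordim F2 i j
   + at_pred (fun i => tordim G i (j - e)%R) i)%N.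
Proof.
move=> a00 b00; rewrite tordim_cone.
- rewrite tordim_dsum.
  + rewrite tordim_shift; congr addn.
    by case: i => //= i; rewrite tordim_shift.
  + exact: shift_graded (res_graded r1).
  + exact: res_acyclic r1.
  + exact: res_graded r2.
  + exact: res_acyclic r2.
- by apply: dsum_graded; [exact: shift_graded (res_graded r1) |
    exact: res_graded r2].
- by apply: dsum_acyclic; [exact: res_acyclic r1 | exact: res_acyclic r2].
- exact: shift_graded (res_graded rG).
- exact: res_acyclic rG.
- by move=> l; rewrite /c map_row_mx map_mxN a00 b00 oppr0 row_mx0.
Qed.

End Cone.

Definition concentrated (r : nat) : fcx :=
  @Fcx _ _ (fun i => if i is 0 then r else 0%N) (fun _ _ => 0)
    (fun i => match i return 'M_(0, if i is 0 then r else 0%N) with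
              | 0 => 0 | _.+1 => 0 end).

Lemma concentrated_graded r : graded_cx (concentrated r).
Proof. by move=> i []. Qed.

Lemma concentrated_acyclic r : acyclic (concentrated r).
Proof.
move=> i w; split=> _; first by exists 0; apply/matrixP => ? [].
by apply/matrixP => ? u; rewrite [w]thinmx0 mul0mx mxE.
Qed.

Lemma resolves0 : resolves (concentrated 0) 0 (fun f : S => mon_ideal pred0 f).
Proof.
split=> [|||f|w].
- exact: concentrated_graded.
- exact: concentrated_acyclic.
- by move=> [].
- split=> [f0|[w /mx11_eq <-]].
    have -> : f = 0.
      apply: msuppnil0; move: f0; rewrite /mon_ideal.
      by case: (msupp f).
    by exists 0; rewrite mulmx0 raddf0.
  by rewrite mulmx0 mxE mon_ideal0.
- split=> _; last by rewrite mulmx0.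
  by exists 0; apply/matrixP => ? [].
Qed.

Lemma resolves1 : resolves (concentrated 1) 1%:M (fun f : S => mon_ideal predT f).
Proof.
split=> [|||f|w].
- exact: concentrated_graded.
- exact: concentrated_acyclic.
- move=> u v m; rewrite mxE !ord1 eqxx mulr1n msupp1 inE => /eqP ->.
  by rewrite mdeg0.
- split=> [_|_]; last by rewrite /mon_ideal all_predT.
  by exists f%:M; rewrite mulmx1.
- rewrite mulmx1; split=> [->|[z ->]]; first by exists 0; rewrite mul0mx.
  by rewrite mulmx0.
Qed.

Lemma mon_cone_exists (U U1 U2 J : pred mon) t (F1 F2 G : fcx)
    (a1 : 'cV[S]_(crk F1 0)) (a2 : 'cV[S]_(crk F2 0)) (aG : 'cV[S]_(crk G 0)) :
  (forall m, U m = (t <= m)%MM && U1 (m - t)%MM || U2 m) ->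
  (forall m, J m = U1 m && U2 (t + m)%MM) ->
  resolves F1 a1 (mon_ideal U1) -> resolves F2 a2 (mon_ideal U2) ->
  resolves G aG (mon_ideal J) ->
  exists (F : fcx) (aF : 'cV[S]_(crk F 0)), resolves F aF (mon_ideal U).
Proof.
move=> defU defJ r1 r2 rG.
have lT m n (D : 'M[S]_(m, n)) : lifts_in predT D := @lifts_inT _ _ _ _ D.
have predTI t' (f : S) : mon_ideal J f -> mon_ideal predT ('X_[t'] * f).
  by rewrite /mon_ideal all_predT.
have J1 (f : S) : mon_ideal J f -> mon_ideal U1 ('X_[0] * f).
  rewrite mpolyX0 mul1r; apply: sub_mon_ideal => m.
  by rewrite !unfold_in defJ => /andP[].
have J2 (f : S) : mon_ideal J f -> mon_ideal U2 ('X_[t] * f).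
  rewrite mon_idealMX; apply: sub_mon_ideal => m.
  by rewrite !unfold_in defJ => /andP[].
have [a [ga ca _ a0]] := resolution_lift (@upclosedT N) rG r1 J1 (lT _ _ _)
  (fun=> lT _ _ _) (predTI _).
have [b [gb cb _ b0]] := resolution_lift (@upclosedT N) rG r2 J2 (lT _ _ _)
  (fun=> lT _ _ _) (predTI _).
eexists; eexists; apply: (mon_cone_resolves defU defJ r1 r2 rG _ ca _ gb cb b0).
  by move=> i u v m /ga ->; rewrite /= mdeg0 addr0.
by rewrite a0 mpolyX0 scale1r.
Qed.

(** Induction on the number of generators: writing the ideal as
    [('X_[t]) + J], the cone needs resolutions of [J] and of [J : 'X_[t]], which
    have one generator less. *)
Lemma generated_resolution (gens : seq mon) :
  exists (F : fcx) (aF : 'cV[S]_(crk F 0)), resolves F aF (mon_ideal (generated gens)).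
Proof.
have [n] := ubnP (size gens); elim: n gens => // n IHn [|t gens] /=.
  by move=> _; exists (concentrated 0), 0; apply: resolves0.
rewrite ltnS => le_n.
have [F2 [a2 r2]] := IHn gens le_n.
have [|G [aG rG]] := IHn [seq (s - t)%MM | s <- gens]; first by rewrite size_map.
apply: (mon_cone_exists (t := t) _ _ resolves1 r2 rG) => m.
  by rewrite /generated /= andbT.
rewrite /generated /= has_map; apply: eq_has => s /=.
by apply/mnm_lepP/mnm_lepP => h i; have := h i; rewrite !mnmBE mnmDE leq_subLR.
Qed.

Lemma span_resolution (T : finType) (D : pred T) (e : T -> mon) :
  exists (F : fcx) (aF : 'cV[S]_(crk F 0)),
    resolves F aF (ideal_span D (fun t => 'X_[e t])).
Proof.
have [F [aF rF]] := generated_resolution [seq e t | t <- enum D].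
exists F, aF; apply: eq_resolves rF => f.
by symmetry; apply: ideal_spanX.
Qed.

End MonomialResolutions.

(** * Adjoining variables *)

Section BaseChange.
Variables (k : fieldType) (N M : nat) (iota : 'I_N -> 'I_M).
Hypothesis iota_inj : injective iota.
Local Notation S := {mpoly k[N]}.
Local Notation T := {mpoly k[M]}.

Definition push (m : 'X_{1..N}) : 'X_{1..M} := (\sum_i U_(iota i) *+ m i)%MM.
Definition pull (m : 'X_{1..M}) : 'X_{1..N} := [multinom m (iota i) | i < N].
Definition rest (m : 'X_{1..M}) : 'X_{1..M} :=
  [multinom if j \in codom iota then 0%N else m j | j < M].

Lemma push_in m i : push m (iota i) = m i.
Proof.
rewrite mnm_sumE (bigD1 i) //= mulmnE mnm1E eqxx mul1n big1 ?addn0 // => i' ne.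
by rewrite mulmnE mnm1E (inj_eq iota_inj) (negPf ne).
Qed.

Lemma push_out m j : j \notin codom iota -> push m j = 0%N.
Proof.
move=> nj; rewrite mnm_sumE big1 // => i _; rewrite mulmnE mnm1E.
by case: eqP => // e; rewrite -e codom_f in nj.
Qed.

Lemma pushK : cancel push pull.
Proof. by move=> m; apply/mnmP => i; rewrite mnmE push_in. Qed.

Lemma pullD m m' : pull (m + m') = (pull m + pull m')%MM.
Proof. by apply/mnmP => i; rewrite mnmDE !mnmE. Qed.

Lemma restD m m' : rest (m + m') = (rest m + rest m')%MM.
Proof. by apply/mnmP => i; rewrite mnmDE !mnmE; case: ifP. Qed.

Lemma rest_push m : rest (push m) = 0%MM.
Proof.
by apply/mnmP => j; rewrite mnm0E mnmE; case: ifP => // /negbT /push_out ->.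
Qed.

Lemma rest_push_pull m : (rest m + push (pull m))%MM = m.
Proof.
apply/mnmP => j; rewrite mnmDE mnmE; case: ifP => [|/negbT nj].
  by case/codomP => i ->; rewrite push_in mnmE.
by rewrite push_out ?addn0.
Qed.

Lemma mdeg_rest m : (mdeg (rest m) <= mdeg m)%N.
Proof. by rewrite -[m in (_ <= mdeg m)%N]rest_push_pull mdegD leq_addr. Qed.

Lemma pull_sum m : pull m = (\sum_j pull U_(j) *+ m j)%MM.
Proof.
apply/mnmP => i; rewrite mnmE mnm_sumE (bigD1 (iota i)) //= mulmnE mnmE mnm1E.
rewrite eqxx mul1n big1 ?addn0 // => j ne.
by rewrite mulmnE mnmE mnm1E (negPf ne).
Qed.

(** The retraction [low] of [ext] sends the adjoined variables to [1], and not
    to [0], so that it loses nothing on polynomials in which their exponents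
    are prescribed. *)
Definition ext : S -> T := comp_mpoly [tuple 'X_(iota i) | i < N].
Definition low : T -> S := comp_mpoly [tuple 'X_[pull U_(j)] | j < M].

HB.instance Definition _ := GRing.LRMorphism.copy ext
  (comp_mpoly [tuple 'X_(iota i) | i < N]).
HB.instance Definition _ := GRing.LRMorphism.copy low
  (comp_mpoly [tuple 'X_[pull U_(j)] | j < M]).

Lemma extX m : ext 'X_[m] = 'X_[push m].
Proof.
rewrite /ext comp_mpolyX -mprodXnE.
by apply: eq_bigr => i _; rewrite tnth_mktuple.
Qed.

Lemma lowX m : low 'X_[m] = 'X_[pull m].
Proof.
rewrite /low comp_mpolyX pull_sum -mprodXnE.
by apply: eq_bigr => i _; rewrite tnth_mktuple.
Qed.

Lemma extE p : ext p = \sum_(m <- msupp p) p@_m *: 'X_[push m].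
Proof.
rewrite {1}(mpolyE p) raddf_sum /=; apply: eq_bigr => m _.
by rewrite linearZ /= extX.
Qed.

Lemma lowE p : low p = \sum_(m <- msupp p) p@_m *: 'X_[pull m].
Proof.
rewrite {1}(mpolyE p) raddf_sum /=; apply: eq_bigr => m _.
by rewrite linearZ /= lowX.
Qed.

Lemma extK : cancel ext low.
Proof.
move=> p; rewrite extE raddf_sum /= [RHS]mpolyE; apply: eq_bigr => m _.
by rewrite linearZ /= lowX pushK.
Qed.

Lemma msupp_ext p m : m \in msupp (ext p) -> exists2 m', m' \in msupp p & m = push m'.
Proof.
have : mon_ideal (mem (map push (msupp p))) (ext p).
  rewrite extE big_seq; apply: mon_ideal_sum => m' h; apply: mon_idealZ.
  by rewrite mon_idealX; apply: map_f.
by move=> /allP h /h /mapP.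
Qed.

Lemma ext0coef p : (ext p)@_0%MM = p@_0%MM.
Proof.
rewrite extE [in RHS](mpolyE p) !raddf_sum /=; apply: eq_bigr => m _.
rewrite !mcoeffZ !mcoeffX; congr (_ * (nat_of_bool _)%:R).
apply/eqP/eqP => [e|->]; first by rewrite -(pushK m) e; apply/mnmP => i; rewrite !mnmE.
by rewrite /push big1 // => i _; rewrite mnm0E mulm0n.
Qed.

(** Slicing writes the larger ring as a free module over the subring, with
    basis the monomials in the adjoined variables. *)
Definition slice t (p : T) : T := restr (fun m => rest m == t) p.

Lemma ext_low_slice t p : 'X_[t] * ext (low (slice t p)) = slice t p.
Proof.
rewrite lowE raddf_sum mulr_sumr /= [RHS]mpolyE !big_seq; apply: eq_bigr => m.
rewrite msupp_restr => /andP[/eqP <- _].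
by rewrite linearZ /= extX -scalerAr -mpolyXD rest_push_pull.
Qed.

Lemma slice_sum d p : (msize p <= d)%N -> p = \sum_(t : 'X_{1..M < d}) slice t p.
Proof.
move=> le_d; apply/mpolyP => m; rewrite raddf_sum /=.
under eq_bigr => t _ do rewrite mcoeff_restr.
have [pm|] := boolP (m \in msupp p); last first.
  rewrite -mcoeff_eq0 => /eqP ->; rewrite big1 // => t _; exact: if_same.
have lt : (mdeg (rest m) < d)%N.
  exact: leq_ltn_trans (mdeg_rest m) (leq_trans (msize_mdeg_lt pm) le_d).
rewrite (bigD1 (BMultinom lt)) //= eqxx big1 ?addr0 // => t.
by rewrite eq_sym -val_eqE /= => /negPf ->.
Qed.

Lemma map_restr_mul (Q : pred 'X_{1..M}) m n p (Z : 'M[T]_(m, n)) (D : 'M[S]_(n, p)) :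
  (forall t u, Q (t + push u)%MM = Q t) ->
  map_mx (restr Q) (Z *m map_mx ext D) = map_mx (restr Q) Z *m map_mx ext D.
Proof.
move=> hQ; apply/matrixP => i j; rewrite !mxE raddf_sum /=.
apply: eq_bigr => l _; rewrite !mxE; apply: restrM => t t'.
by case/msupp_ext => u _ ->.
Qed.

Lemma slice_stable (t u : 'X_{1..M}) v : (rest (u + push v) == t) = (rest u == t).
Proof. by rewrite restD rest_push addm0. Qed.

(** Flatness: the slices of a syzygy over the larger ring are monomials times
    syzygies over the subring, and finitely many of them sum up to it. *)
Lemma ext_exact a b c (D1 : 'M[S]_(a, b)) (D2 : 'M[S]_(c, a)) :
  (forall w : 'rV_a, w *m D1 = 0 <-> exists z, w = z *m D2) ->
  forall w : 'rV_a, w *m map_mx ext D1 = 0 <-> exists z, w = z *m map_mx ext D2.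
Proof.
move=> h w; split=> [w0|[z ->]]; last first.
  rewrite -mulmxA -map_mxM; suff -> : D2 *m D1 = 0 by rewrite map_mx0 mulmx0.
  apply/row_matrixP => j; rewrite row_mul row0; apply/h.
  by exists (delta_mx 0 j); rewrite -rowE.
pose d := \max_j msize (w ord0 j).
have /fin_all_exists[z hz] (t : 'X_{1..M < d}) :
    exists z, map_mx (slice t) w = z *m map_mx ext D2.
  have [z ez] : exists z, map_mx low (map_mx (slice t) w) = z *m D2.
    apply/h; rewrite -[D1](_ : map_mx low (map_mx ext D1) = _); last first.
      by apply/matrixP => i j; rewrite !mxE extK.
    by rewrite -map_mxM -map_restr_mul ?w0 ?map_mx0 //; apply: slice_stable.
  (* Multiplication by ['X_[t]] restores the exponents that [low] forgets. *)
  exists ('X_[t] *: map_mx ext z); rewrite -scalemxAl -map_mxM -ez.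
  by apply/matrixP => i j; rewrite !mxE ext_low_slice.
exists (\sum_t z t); rewrite mulmx_suml.
under eq_bigr => t _ do rewrite -hz.
apply/matrixP => i j; rewrite summxE ord1.
under eq_bigr => t _ do rewrite mxE.
by apply: slice_sum; apply: (leq_bigmax j).
Qed.

Definition ext_cx (F : fcx k N) : fcx k M :=
  Fcx (@cdg _ _ F) (fun i => map_mx ext (cdiff F i)).

Lemma ext_graded m n r c (A : 'M[S]_(m, n)) :
  graded_mx r c A -> graded_mx r c (map_mx ext A).
Proof.
move=> h i j t; rewrite mxE => /msupp_ext[u /h <- ->].
rewrite /push mdeg_sum (eq_bigr u) ?mdegE // => l _.
by rewrite mdegMn mdeg1 mul1n.
Qed.

Lemma ext_resolves (U : pred 'X_{1..N}) F aF :
  upclosed U -> resolves F aF (fun f => mon_ideal U f) ->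
  resolves (ext_cx F) (map_mx ext aF) (fun f : T => mon_ideal (U \o pull) f).
Proof.
move=> up rF; split.
- by move=> i; apply: ext_graded; apply: (res_graded rF).
- by move=> i w; apply: ext_exact; apply: (res_acyclic rF).
- exact: ext_graded (res_aug_graded rF).
- move=> f; split=> [Uf|[w /mx11_eq <-]]; last first.
    rewrite mxE; apply: mon_ideal_sum => l _; apply: mon_idealMl.
      by move=> m m' /= h; rewrite pullD; apply: up.
    apply/allP => m; rewrite mxE => /msupp_ext[u uF ->].
    by rewrite /= pushK; apply: (allP (resolves_aug_in _ rF)) uF.
  have /fin_all_exists[w hw] (t : 'X_{1..M < msize f}) :
      exists w, w *m map_mx ext aF = (slice t f)%:M.
    have /(res_im rF)[w hw] : mon_ideal U (low (slice t f)).
      rewrite lowE big_seq; apply: mon_ideal_sum => m.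
      rewrite msupp_restr => /andP[_ mf]; apply: mon_idealZ.
      by rewrite mon_idealX; apply: (allP Uf).
    exists ('X_[t] *: map_mx ext w).
    rewrite -scalemxAl -map_mxM hw map_scalar_mx scale_scalar_mx.
    by congr (_%:M); apply: ext_low_slice.
  exists (\sum_t w t); rewrite mulmx_suml.
  under eq_bigr => t _ do rewrite hw.
  by rewrite -raddf_sum /= -slice_sum.
- exact: ext_exact (res_ker rF).
Qed.

Lemma tordim_ext F i j : tordim (ext_cx F) i j = tordim F i j.
Proof.
have kd l : kdiff (ext_cx F) l = kdiff F l.
  by apply/matrixP => u v; rewrite !mxE ext0coef.
by rewrite /tordim /bdim; case: i => [|i] /=; rewrite !kd.
Qed.

Definition new_vars : pred 'X_{1..M} := fun m => rest m != 0%MM.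

Lemma new_vars_up : upclosed new_vars.
Proof. by move=> m m'; rewrite /new_vars restD mnmD_eq0 => /negPf ->. Qed.

(** Matrices over the subring commute with the projection onto the ideal of the
    adjoined variables, so a preimage can be projected. *)
Lemma lifts_in_new_vars m n (D : 'M[S]_(m, n)) : lifts_in new_vars (map_mx ext D).
Proof.
move=> p Z vW; exists (map_mx (restr new_vars) Z).
  by move=> i j; rewrite mxE mon_ideal_restr.
rewrite -map_restr_mul => [|t u]; last by rewrite /new_vars slice_stable.
by apply/matrixP => i j; rewrite mxE restr_id //; apply: vW.
Qed.

Lemma new_vars_mod0 m n (A : 'M[T]_(m, n)) :
  entries_in new_vars A -> map_mx (mcoeff 0%MM) A = 0.
Proof.
move=> h; apply/matrixP => i j; rewrite !mxE; apply/eqP; rewrite mcoeff_eq0.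
apply/negP => /(allP (h i j)); rewrite /new_vars /= => /eqP; apply.
by apply/mnmP => l; rewrite mnmE mnm0E if_same.
Qed.

End BaseChange.

(** * Letterplace ideals *)

Section LetterplaceMonomials.
Variables (k : fieldType) (m : nat) (d : Order.disp_t) (Q : finPOrderType d).
Local Notation mon := 'X_{1..#|{: 'I_m * Q}|}.

(** The monomials of the letterplace ideal: as the variables of a generator are
    distinct, divisibility means that all of them occur. *)
Definition has_multichain (u : mon) : bool :=
  [exists q : {ffun 'I_m -> Q},
    multichain q && [forall i, u (enum_rank (i, q i)) != 0%N]].

Definition chain_mon (q : {ffun 'I_m -> Q}) : mon :=
  (\sum_(i < m) U_(enum_rank (i, q i)))%MM.

Lemma chain_monE (q : {ffun 'I_m -> Q}) :
  \prod_(i < m) lp_var k i (q i) = 'X_[chain_mon q].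
Proof. by rewrite /chain_mon -mprodXE. Qed.

Lemma chain_mon_le q (u : mon) :
  (chain_mon q <= u)%MM = [forall i, u (enum_rank (i, q i)) != 0%N].
Proof.
apply/mnm_lepP/forallP => [h i|h j].
  apply: contraTneq (h (enum_rank (i, q i))) => ->.
  by rewrite mnm_sumE (bigD1 i) //= mnm1E eqxx.
rewrite mnm_sumE; case: (pickP (fun i => enum_rank (i, q i) == j)) => [i /eqP <-|no].
  rewrite (bigD1 i) //= mnm1E eqxx big1 ?addn0 ?lt0n //= => i' ne.
  rewrite mnm1E (inj_eq enum_rank_inj) xpair_eqE.
  by rewrite (negPf ne).
by rewrite big1 // => i _; rewrite mnm1E no.
Qed.

Lemma letterplace_mon f :
  letterplace k m Q f <-> mon_ideal has_multichain f.
Proof.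
have e : (fun q : {ffun 'I_m -> Q} => \prod_(i < m) lp_var k i (q i)) =1
    fun q => 'X_[chain_mon q] by move=> q; apply: chain_monE.
have -> : mon_ideal has_multichain f =
    mon_ideal (generated [seq chain_mon q | q <- enum (@multichain m d Q)]) f.
  apply: eq_mon_ideal => u; apply/existsP/hasP => [[q /andP[mq uq]]|].
    exists (chain_mon q); last by rewrite chain_mon_le.
    by apply: map_f; rewrite mem_enum.
  case=> _ /mapP[q + ->]; rewrite mem_enum chain_mon_le => mq uq.
  by exists q; rewrite uq andbT.
rewrite -ideal_spanX /letterplace /ideal_span.
by split=> -[c ->]; exists c; apply: eq_bigr => q _; rewrite e.
Qed.

Lemma has_multichain_up : upclosed has_multichain.
Proof.
move=> u v /existsP[q /andP[mq /forallP h]]; apply/existsP; exists q.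
rewrite mq; apply/forallP => i; rewrite mnmDE.
by apply: contra (h i); rewrite addn_eq0 => /andP[].
Qed.

Lemma letterplace_resolution : exists (F : fcx k _) aF,
  resolves F aF (fun f => mon_ideal has_multichain f).
Proof.
have [F [aF rF]] := span_resolution k (@multichain m d Q) chain_mon.
exists F, aF; apply: eq_resolves rF => f; rewrite -letterplace_mon.
by rewrite /letterplace /ideal_span; split=> -[c ->]; exists c;
  apply: eq_bigr => q _; rewrite chain_monE.
Qed.

Lemma letterplace_betti (F : fcx k _) aF i j :
  resolves F aF (fun f => mon_ideal has_multichain f) ->
  betti (letterplace k m Q) i%:Z j = tordim F i j.
Proof.
move=> rF; apply: betti_tordim; apply: eq_resolves rF => f.
by symmetry; apply: letterplace_mon.
Qed.

End LetterplaceMonomials.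

(** Below [b] there is a minimal element, by finiteness, and it can only be
    [a]. *)
Lemma unique_minimal_le (d : Order.disp_t) (P : finPOrderType d) (a b : P) :
  unique_minimal a -> (a <= b)%O.
Proof.
case=> _ uniq.
case: (@arg_minnP _ b (fun c => c <= b)%O (fun c => #|[pred x | (x <= c)%O]|)) => //.
move=> c cb cmin; rewrite -(uniq c) // => x; apply/negP => xc.
have := cmin x (le_trans (ltW xc) cb); rewrite leqNgt => /negP; apply.
apply: proper_card; apply/properP; split.
  by apply/subsetP => y; rewrite !inE => /le_trans; apply; apply: ltW.
by exists c; rewrite !inE ?lexx // lt_geF.
Qed.

Section MinimalElement.
Variables (k : fieldType) (n : nat) (d : Order.disp_t) (P : finPOrderType d).
Variable a : P.
Hypothesis a_min : forall b : P, (a <= b)%O.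
Local Notation var := 'I_#|{: 'I_n.+1 * P}|.
Local Notation mon := 'X_{1..#|{: 'I_n.+1 * P}|}.

Definition skip_row (v : 'I_#|{: 'I_n * P}|) : var :=
  enum_rank (lift ord0 (enum_val v).1, (enum_val v).2).

Definition drop_min (v : 'I_#|{: 'I_n.+1 * poset_del a}|) : var :=
  enum_rank ((enum_val v).1, val (enum_val v).2).

Lemma skip_row_inj : injective skip_row.
Proof.
move=> u v /enum_rank_inj e; apply: enum_val_inj.
rewrite [LHS]surjective_pairing [RHS]surjective_pairing; congr pair.
  exact: lift_inj (congr1 fst e).
by have /= := congr1 snd e.
Qed.

Lemma drop_min_inj : injective drop_min.
Proof.
move=> u v /enum_rank_inj e; apply: enum_val_inj.
rewrite [LHS]surjective_pairing [RHS]surjective_pairing; congr pair.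
  by have /= := congr1 fst e.
exact: val_inj (congr1 snd e).
Qed.

Definition min_var : var := enum_rank (ord0, a).
Local Notation t := U_(min_var)%MM.
Local Notation U := (@has_multichain n.+1 d P).

(** The monomials of [L'] and of [L''] in the ring of [L]. *)
Definition tail_chain : pred mon := @has_multichain n d P \o pull skip_row.
Definition chain_off_min : pred mon :=
  @has_multichain n.+1 d (poset_del a) \o pull drop_min.

Lemma tail_chainP (u : mon) : reflect
  (exists2 q : {ffun 'I_n -> P}, multichain q &
    forall i, u (enum_rank (lift ord0 i, q i)) != 0%N) (tail_chain u).
Proof.
apply: (iffP existsP) => [[q /andP[mq /forallP h]]|[q mq h]]; exists q => //.
  by move=> i; have := h i; rewrite mnmE /skip_row enum_rankK.
by rewrite mq; apply/forallP => i; rewrite mnmE /skip_row enum_rankK.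
Qed.

Lemma chain_off_minP (u : mon) : reflect
  (exists q : {ffun 'I_n.+1 -> P}, [/\ multichain q, forall i, q i != a &
    forall i, u (enum_rank (i, q i)) != 0%N]) (chain_off_min u).
Proof.
apply: (iffP existsP) => [[q /andP[mq /forallP h]]|[q [mq na h]]].
  exists [ffun i => val (q i)]; split=> [|i|i].
  - apply/forallP => i; apply/forallP => l; rewrite !ffunE.
    by have := forallP (forallP mq i) l; rewrite leEsub.
  - by rewrite ffunE (valP (q i)).
  - by have := h i; rewrite mnmE /drop_min enum_rankK ffunE.
exists [ffun i => exist (fun x => x != a) (q i) (na i) : poset_del a].
apply/andP; split; last first.
  by apply/forallP => i; rewrite mnmE /drop_min enum_rankK /= ffunE.
apply/forallP => i; apply/forallP => l; rewrite !ffunE leEsub /=.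
exact: (forallP (forallP mq i) l).
Qed.

Lemma multichain_le m (Q : finPOrderType d) (q : {ffun 'I_m -> Q}) (i l : 'I_m) :
  multichain q -> (i <= l)%N -> (q i <= q l)%O.
Proof. by move=> /forallP/(_ i)/forallP/(_ l)/implyP h /h. Qed.

Lemma sub_min_lift (u : mon) (i : 'I_n) (x : P) :
  (u - t)%MM (enum_rank (lift ord0 i, x)) = u (enum_rank (lift ord0 i, x)).
Proof.
rewrite mnmBE mnm1E (inj_eq enum_rank_inj) xpair_eqE.
by rewrite (negPf (neq_lift _ _)) subn0.
Qed.

(** A multichain that does not start at [a] avoids [a] altogether, since [a] is
    the least element. *)
Lemma multichain_split (u : mon) :
  U u = (t <= u)%MM && tail_chain (u - t)%MM || chain_off_min u.
Proof.
apply/existsP/orP => [[q /andP[mq /forallP h]]|].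
  have [q0|q0] := eqVneq (q ord0) a; [left|right].
    apply/andP; split; first by rewrite lep1mP /min_var -q0.
    apply/tail_chainP; exists [ffun i => q (lift ord0 i)] => [|i].
      apply/forallP => i; apply/forallP => l; apply/implyP => le.
      by rewrite !ffunE; apply: (multichain_le mq); rewrite !lift0 ltnS.
    by rewrite ffunE sub_min_lift.
  apply/chain_off_minP; exists q; split=> // i.
  apply: contraNneq q0 => qi; rewrite eq_le a_min andbT -qi.
  exact: (multichain_le mq).
case=> [/andP[ta /tail_chainP[q mq h]]|/chain_off_minP[q [mq _ h]]]; last first.
  by exists q; rewrite mq; apply/forallP.
exists [ffun i => if unlift ord0 i is Some l then q l else a].
apply/andP; split; apply/forallP => i; last first.
  rewrite ffunE; case: unliftP => [l ->|->]; last by rewrite -lep1mP.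
  by rewrite -sub_min_lift.
apply/forallP => l; apply/implyP; rewrite !ffunE.
case: (unliftP ord0 i) => [i' ->|->]; last by rewrite a_min.
case: (unliftP ord0 l) => [l' ->|->]; last by rewrite lift0.
by rewrite !lift0 ltnS; apply: (multichain_le mq).
Qed.

(** [L''] is contained in [L'], and [x] is a nonzerodivisor modulo [L'']. *)
Lemma chain_off_min_colon (u : mon) :
  chain_off_min u = tail_chain u && chain_off_min (t + u)%MM.
Proof.
apply/chain_off_minP/andP => [[q [mq na h]]|[_ /chain_off_minP[q [mq na h]]]].
  split; last first.
    apply/chain_off_minP; exists q; split=> // i; rewrite mnmDE.
    by apply: contra (h i); rewrite addn_eq0 => /andP[].
  apply/tail_chainP; exists [ffun i => q (lift ord0 i)] => [|i]; last by rewrite ffunE.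
  apply/forallP => i; apply/forallP => l; apply/implyP => le.
  by rewrite !ffunE; apply: (multichain_le mq); rewrite !lift0 ltnS.
exists q; split=> // i; have := h i; rewrite mnmDE mnm1E.
rewrite (inj_eq enum_rank_inj) xpair_eqE [a == _]eq_sym (negPf (na i)) andbF.
by rewrite add0n.
Qed.

Lemma chain_off_min_new_vars (u : mon) : chain_off_min u -> new_vars skip_row u.
Proof.
case/chain_off_minP => q [_ _ h]; apply: contraNneq (h ord0) => e.
have := congr1 (fun v : mon => v (enum_rank (ord0, q ord0))) e.
rewrite mnm0E mnmE; case: ifP => [/codomP[v /enum_rank_inj[/eqP]]|_ ->] //.
Qed.

Lemma betti_split i j :
  betti (letterplace k n.+1 P) i%:Z j =
    (betti (letterplace k n.+1 (poset_del a)) i%:Z j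
     + betti (letterplace k n P) i%:Z (j - 1)
     + betti (letterplace k n.+1 (poset_del a)) (i%:Z - 1) (j - 1))%N.
Proof.
have [F1s [a1s r1s]] := letterplace_resolution k n P.
have [F2s [a2s r2s]] := letterplace_resolution k n.+1 (poset_del a).
have r1 := ext_resolves skip_row_inj (@has_multichain_up n d P) r1s.
have r2 := ext_resolves drop_min_inj (@has_multichain_up _ _ _) r2s.
rewrite -/tail_chain in r1; rewrite -/chain_off_min in r2.
set F1 := ext_cx skip_row F1s in r1; set F2 := ext_cx drop_min F2s in r2.
have lF1 m' n' (D : 'M[{mpoly k[_]}]_(m', n')) :
    lifts_in (new_vars skip_row) (map_mx (ext skip_row) D).
  exact: lifts_in_new_vars.
have sub (f : {mpoly k[_]}) :
    mon_ideal chain_off_min f -> mon_ideal tail_chain ('X_[0] * f).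
  rewrite mpolyX0 mul1r; apply: sub_mon_ideal => u U2u.
  by have : chain_off_min u := U2u; rewrite chain_off_min_colon => /andP[].
have subV (f : {mpoly k[_]}) : mon_ideal chain_off_min f ->
    mon_ideal (new_vars skip_row) ('X_[0] * f).
  by rewrite mpolyX0 mul1r; apply: sub_mon_ideal => u; apply: chain_off_min_new_vars.
(* Multiplication by [1] is the inclusion of [L''] into [L']. *)
have [b [gb cb vb b0]] := resolution_lift (@new_vars_up _ _ skip_row) r2 r1 sub
  (lF1 _ _ _) (fun=> lF1 _ _ _) subV.
(* Multiplication by [x_(1,a)], lifted to itself on the resolution of [L'']. *)
pose x l : 'M[{mpoly k[_]}]_(crk F2 l) := 'X_[t]%:M.
have gb' : graded_map (F := F1) (G := F2) b.
  by move=> l u v m' /gb ->; rewrite /= mdeg0 addr0.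
have b0' : b 0%N *m map_mx (ext skip_row) a1s = map_mx (ext drop_min) a2s.
  by rewrite b0 mpolyX0 scale1r.
have gx : graded_map (F := F2) (G := shift (mdeg t)%:Z F2) x.
  by move=> l; apply: graded_mx_scalar => v; rewrite /= addrC.
have cx : chain_map (F := F2) (G := F2) x.
  by move=> l; rewrite /x scalar_mxC.
have x0 : x 0%N *m map_mx (ext drop_min) a2s =
    'X_[t] *: map_mx (ext drop_min) a2s by rewrite mul_scalar_mx.
have rC := mon_cone_resolves multichain_split chain_off_min_colon r1 r2 r2
  gb' cb b0' gx cx x0.
rewrite (letterplace_betti _ _ rC) (tordim_mon_cone t r1 r2 r2); first last.
- by move=> l; rewrite map_scalar_mx /= mcoeffX mnm1_eq0 raddf0.
- by move=> l; apply: new_vars_mod0; apply: vb.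
rewrite mdeg1; congr addn.
  rewrite (tordim_ext skip_row_inj) (tordim_ext drop_min_inj) addnC.
  by rewrite (letterplace_betti _ _ r1s) (letterplace_betti _ _ r2s).
case: i {rC} => [//|i].
have -> : i.+1%:Z - 1 = i%:Z by rewrite -addn1 PoszD addrK.
rewrite (letterplace_betti _ _ r2s); exact: tordim_ext drop_min_inj _ _ _.
Qed.

End MinimalElement.

Theorem corollary4p2 (n : nat) (k : fieldType) (d : Order.disp_t)
    (P : finPOrderType d) (a : P) (i j : int) :
  (2 <= n)%N -> unique_minimal a -> (0 <= i)%R ->
  betti (letterplace k n P) i j =
    (betti (letterplace k n (poset_del a)) i j
     + betti (letterplace k n.-1 P) i (j - 1)%R
     + betti (letterplace k n (poset_del a)) (i - 1)%R (j - 1)%R)%N.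
Proof.
case: n i => [|n] [i|i] // _ a_min _.
by apply: betti_split => b; apply: unique_minimal_le.
Qed.
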